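(* There exists a constant $C>0$ such that, for all integers $n\ge 3$ and $k\ge 3$, every $n$-vertex outerpath whose internal faces all have size at most $k$ admits an internally-strictly-convex grid drawing of area at most $C\,n k^{2}$.
   Context: A graph is outerplanar if it admits a planar drawing with all vertices on the outer face; a biconnected outerplanar graph has a unique outerplanar embedding (up to reflection), whose bounded faces are its internal faces. The size of a face is the number of vertices on its boundary. The weak dual of a biconnected outerplane graph is the tree with one vertex per internal face, two being adjacent when the corresponding faces share an edge. An outerpath is a biconnected outerplanar graph whose weak dual is a path. A grid drawing maps vertices to distinct integer points. An internally-strictly-convex drawing is a planar straight-line drawing (edges are segments, no two edges intersect except at common endpoints) in which every internal (bounded) face is bounded by a polygon all of whose internal angles are strictly smaller than $180^\circ$. For a grid drawing $\Gamma$, width $=\max_x(\Gamma)-\min_x(\Gamma)+1$, height $=\max_y(\Gamma)-\min_y(\Gamma)+1$ (extremes of vertex coordinates), and area $=$ width $\times$ height. *)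

(* Defs.v *)
From HB Require Import structures.
From mathcomp Require Import all_boot all_order all_algebra.
From mathcomp Require Import all_classical all_reals.
From mathcomp Require Import fingroup perm topology Rstruct Rstruct_topology.
Set Implicit Arguments. Unset Strict Implicit. Unset Printing Implicit Defensive.
Import Order.TTheory GRing.Theory Num.Theory.
Local Open Scope ring_scope.

Notation RR := Rdefinitions.R.
Definition point := (RR * RR)%type.

Definition simple_graph n (e : rel 'I_n) :=
  (forall u v, e u v = e v u) /\ (forall u, ~~ e u u).

(* [pos] is the cyclic position of each vertex along the outer face.
   A biconnected outerplane graph (n >= 3): the outer face is the Hamiltonian
   cycle pos^-1 0, pos^-1 1, ..., pos^-1 (n-1), and the remaining edges are
   chords that do not cross (in the outerplanar embedding, with all vertices
   on the outer face in this cyclic order). *)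
Definition outerplane_embedding n (e : rel 'I_n) (pos : {perm 'I_n}) :=
  (forall u v : 'I_n, (val (pos v) = (val (pos u)).+1 %% n)%N -> e u v) /\
  (forall a b c d : 'I_n, e a b -> e c d ->
     ~ [/\ (pos a < pos c)%N, (pos c < pos b)%N & (pos b < pos d)%N]).

(* x and y (distinct, in S) are consecutive along the boundary cycle of the
   convex-position polygon with vertex set S: one of the two open arcs of the
   outer cycle between them contains no element of S. *)
Definition consecutive_in n (pos : {perm 'I_n}) (S : {set 'I_n}) (x y : 'I_n) :=
  let lo := minn (pos x) (pos y) in
  let hi := maxn (pos x) (pos y) in
  [forall z in S, ~~ ((lo < pos z) && (pos z < hi))%N] ||
  [forall z in S, ((lo <= pos z) && (pos z <= hi))%N].

(* The internal faces of the (unique) outerplanar embedding, as vertex sets: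
   S (|S| >= 3) bounds an internal face iff the consecutive vertices of S are
   adjacent and no other pair of vertices of S is adjacent (no chord inside). *)
Definition internal_face n (e : rel 'I_n) (pos : {perm 'I_n}) (S : {set 'I_n}) :=
  (3 <= #|S|)%N /\
  forall x y, x \in S -> y \in S -> x != y -> (e x y <-> consecutive_in pos S x y).

Definition faces_adjacent n (e : rel 'I_n) (F G : {set 'I_n}) :=
  F != G /\ exists x y, [/\ x \in F :&: G, y \in F :&: G & e x y].

Definition weak_dual_is_path n (e : rel 'I_n) (pos : {perm 'I_n}) :=
  exists s : seq {set 'I_n},
    [/\ uniq s,
        (forall F, F \in s <-> internal_face e pos F) &
        forall i j, (i < size s)%N -> (j < size s)%N ->
          (faces_adjacent e (nth finset.set0 s i) (nth finset.set0 s j) <->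
             (i.+1 == j) || (j.+1 == i))].

Definition outerpath n (e : rel 'I_n) (pos : {perm 'I_n}) :=
  outerplane_embedding e pos /\ weak_dual_is_path e pos.

Local Open Scope classical_set_scope.

Definition to_point (q : int * int) : point := ((q.1)%:~R, (q.2)%:~R).

Definition segment (a b : point) : set point :=
  [set x | exists t : RR, [/\ 0 <= t, t <= 1 &
            x = (a.1 + t * (b.1 - a.1), a.2 + t * (b.2 - a.2))]].

Definition planar_straight_line n (e : rel 'I_n) (p : 'I_n -> int * int) :=
  injective p /\
  forall a b c d : 'I_n, e a b -> e c d -> ~~ ((a == c) && (b == d) || (a == d) && (b == c)) ->
    forall x, segment (to_point (p a)) (to_point (p b)) x ->
              segment (to_point (p c)) (to_point (p d)) x ->
      exists2 v, ((v == a) || (v == b)) && ((v == c) || (v == d)) & x = to_point (p v).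

Definition drawing_set n (e : rel 'I_n) (p : 'I_n -> int * int) : set point :=
  [set x | exists a b, e a b /\ segment (to_point (p a)) (to_point (p b)) x].

Definition bounded_pt (A : set point) :=
  exists M : RR, forall x, A x -> `|x.1| <= M /\ `|x.2| <= M.

Definition drawing_internal_face n (e : rel 'I_n) (p : 'I_n -> int * int)
    (F : set point) :=
  exists2 x, (~` drawing_set e p) x &
    F = connected_component (~` drawing_set e p) x /\ bounded_pt F.

Definition convex_pt (A : set point) :=
  forall x y, A x -> A y -> segment x y `<=` A.

Definition extreme_pt (A : set point) (x : point) :=
  forall y z, A y -> A z -> y != z -> segment y z x -> x = y \/ x = z.

(* internally-strictly-convex: every internal face is bounded by a polygon
   with all internal angles < 180 degrees, i.e. the face is convex and every
   vertex on its boundary is a corner (no angle equal to 180 degrees). *)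
Definition internally_strictly_convex n (e : rel 'I_n) (p : 'I_n -> int * int) :=
  planar_straight_line e p /\
  forall F, drawing_internal_face e p F ->
    convex_pt F /\
    forall v, closure F (to_point (p v)) -> extreme_pt (closure F) (to_point (p v)).

Local Close Scope classical_set_scope.
Definition seq_max (s : seq int) : int := \big[Order.max/head 0 s]_(x <- s) x.
Definition seq_min (s : seq int) : int := \big[Order.min/head 0 s]_(x <- s) x.
Definition width n (p : 'I_n -> int * int) : int :=
  let xs := [seq (p v).1 | v <- enum 'I_n] in seq_max xs - seq_min xs + 1.
Definition height n (p : 'I_n -> int * int) : int :=
  let ys := [seq (p v).2 | v <- enum 'I_n] in seq_max ys - seq_min ys + 1.
Definition area n (p : 'I_n -> int * int) : int := width p * height p.

(* Main.v *)
Require Import Defs.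
From HB Require Import structures.
From mathcomp Require Import all_boot all_order all_algebra.
From mathcomp Require Import all_classical all_reals.
From mathcomp Require Import fingroup perm topology Rstruct Rstruct_topology.
From mathcomp Require Import normedtype.
From mathcomp Require Import zify ring lra.
Set Implicit Arguments. Unset Strict Implicit. Unset Printing Implicit Defensive.
Import Order.TTheory GRing.Theory Num.Theory.
Import numFieldTopology.Exports numFieldNormedType.Exports.
Local Open Scope classical_set_scope.
Local Open Scope ring_scope.

(** The chords of an outerpath, together with two suitable edges of the outer
    cycle, all join one side of that cycle (the top) to the other (the bottom),
    since otherwise some face would have three neighbours in the weak dual.
    Sorted from left to right they are c_0, ..., c_m, and face number i lies
    between c_i and c_(i+1).

    Put the top ends of the chords on a horizontal line and the bottom ends on
    another one, at vertical distance K = 2k, at abscissae that are multiples of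
    K. Chord i then has direction (q_i, 1) with an integer q_i, so an integral
    shear makes it vertical. After this shear the top path of a face with t top
    edges is drawn through (s^2, s) for s < t and comes down to the line in one
    last edge; the bottom path is symmetric. The bulges are less than k high and
    have slope |q_i| = O(n), so width O(nk) and height O(k) suffice.

    Bulges drawn from different chords must not collide, although a fan around
    a top vertex lets q_i drop from one side of that vertex to the other. Each
    top vertex gets a ray of slope rho above it, and the faces are kept in the
    sectors between these rays (and similarly rays of slope tau below the
    bottom vertices). Where neighbouring rays converge, the face between them is
    widened by half of the drop of q; since every drop is charged to one face
    only and one half is contracting, the total width remains O(nk). *)

(** * Convex polygons and connected components *)

(** The goal speaks of all bounded components of the complement, so drawing convex faces is only
    half of the work: every point outside the closed faces must also be shown to lie in an unbounded
    component. The sectors serve both purposes. They separate the faces from one another, and inside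
    the sector of a face a point outside that face can escape along an interpolated ray.

    The 2 in [K = 2 * k] matches the one half of the drop by which a face is widened. If a face has
    width [w], in units of [K], and [t] top edges, its right ray may lean towards its left chord
    with relative slope up to [2 * w - 2 * t]. Up to height [k] the two come closer by at most
    [2 * k * w - 2 * k * t], less than their distance [K * w] at the base. The term [- 2 * t] leaves
    the room for the parabola.

    The parabola itself costs up to [k ^ 2] in width, which is within [n * k] only if [k <= n]; the
    drawing is therefore scaled with the smaller of [k] and [n]. *)

Notation plane := Defs.point.

Definition cross (a b z : plane) : RR :=
  (b.1 - a.1) * (z.2 - a.2) - (b.2 - a.2) * (z.1 - a.1).

Lemma continuous_affine2 (K : realType) (a b c d : K) :
  continuous (fun w : K * K => a * (w.2 - b) - c * (w.1 - d)).
Proof.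
move=> z.
have c1 : {for z, continuous (fun w : K * K => w.1)} by exact: cvg_fst.
have c2 : {for z, continuous (fun w : K * K => w.2)} by exact: cvg_snd.
have cc (e : K) : {for z, continuous (fun w : K * K => e)} by exact: cvg_cst.
exact: (continuousB (continuousM (cc a) (continuousB c2 (cc b)))
  (continuousM (cc c) (continuousB c1 (cc d)))).
Qed.

Lemma continuous_line (K : realType) (a b c d : K) :
  continuous (fun t : K => (a + t * b, c + t * d)).
Proof.
move=> t.
have ct : {for t, continuous (fun u : K => u)} by exact: cvg_id.
have cc (e : K) : {for t, continuous (fun u : K => e)} by exact: cvg_cst.
have h1 := continuousD (cc a) (continuousM ct (cc b)).
have h2 := continuousD (cc c) (continuousM ct (cc d)).
exact: (cvg_pair h1 h2).
Qed.

Lemma continuous_cross a b : continuous (cross a b).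
Proof. exact: (@continuous_affine2 RR). Qed.

Lemma segmentl a b : segment a b a.
Proof. by exists 0; split => //; rewrite !mul0r !addr0; case: a. Qed.

Lemma segmentr a b : segment a b b.
Proof. by exists 1; split => //; rewrite !mul1r !subrKC; case: b. Qed.

Lemma segmentC a b z : segment a b z -> segment b a z.
Proof.
move=> [t [t0 t1 ->]]; exists (1 - t); split; [lra|lra|].
by congr pair; ring.
Qed.

Lemma connected_segment a b : connected (segment a b).
Proof.
pose f (t : RR) : plane := (a.1 + t * (b.1 - a.1), a.2 + t * (b.2 - a.2)).
have -> : segment a b = [set f x | x in `[0, 1]].
  apply/seteqP; split => [z [t [t0 t1 ->]]|z [t]] /=.
    by exists t => //=; rewrite in_itv /= t0 t1.
  by rewrite in_itv /= => /andP[t0 t1] <-; exists t.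
apply: connected_continuous_connected; first exact: segment_connected.
apply: continuous_subspaceT; exact: (@continuous_line RR).
Qed.

Lemma segment_component (A : set plane) a b :
  segment a b `<=` A -> connected_component A a b.
Proof.
move=> sA; apply: (connected_component_max (segmentl a b) sA) => //.
  exact: connected_segment.
exact: segmentr.
Qed.

(** Off [D] the sets [O] and [C] agree, so [O] cuts the component of [x] in a nonempty open and
    closed subset, hence in all of it. Convexity of [O] gives the other inclusion. *)
Lemma component_open_face (D O C : set plane) x :
  open O -> closed C -> O `<=` C -> C `\` O `<=` D -> O `&` D = set0 ->
  convex_pt O -> O x -> connected_component (~` D) x = O.
Proof.
move=> Oo Cc OC CD OD Ocv Ox.
have ODn y : O y -> ~ D y.
  by move=> Oy Dy; have : (O `&` D) y by []; rewrite OD.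
apply/seteqP; split; last first.
  move=> y Oy; apply: segment_component => z /(Ocv _ _ Ox Oy).
  exact: ODn.
set F := connected_component _ x.
have Fx : F x by apply: connected_component_refl; exact: ODn.
have FD : F `<=` ~` D by exact: connected_component_sub.
suff <- : F `&` O = F by move=> y [].
have cF : connected F by exact: component_connected.
apply: cF; first by exists x.
- by exists O.
- exists C => //; apply/seteqP; split => z [Fz].
    by move=> Oz; split => //; exact: OC.
  move=> Cz; split => //; apply: contrapT => nO.
  by apply: (FD z Fz); apply: CD.
Qed.

(** Strict convexity without a cyclic order: [N] is the set of directed edges, each continued at
    both ends by an edge that does not turn back, and any other source of an edge lies strictly to
    the left. That distinct vertices are distinct points follows, see [polygon_vertex_inj]. *)
Definition ccw_polygon (L : eqType) (P : L -> plane) (N : rel L) :=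
  [/\ forall x, ~~ N x x,
      forall x y, N x y -> exists2 w, N w x & w != y,
      forall x y, N x y -> exists2 w, N y w & w != x &
      forall x y z w, N x y -> N z w -> z != x -> z != y ->
        0 < cross (P x) (P y) (P z)].

Section Polygon.
Variables (L : eqType) (P : L -> plane) (N : rel L).
Hypothesis PN : ccw_polygon P N.

Definition poly_closed : set plane :=
  [set z | forall x y, N x y -> 0 <= cross (P x) (P y) z].
Definition poly_open : set plane :=
  [set z | forall x y, N x y -> 0 < cross (P x) (P y) z].

Lemma poly_open_sub : poly_open `<=` poly_closed.
Proof. by move=> z oz x y /oz /ltW. Qed.

Lemma crossE a b c d t :
  cross a b (c.1 + t * (d.1 - c.1), c.2 + t * (d.2 - c.2)) =
  (1 - t) * cross a b c + t * cross a b d.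
Proof. rewrite /cross /=; ring. Qed.

Lemma convex_comb_eq0 (t a b : RR) : t < 1 -> 0 <= t -> 0 <= a -> 0 <= b ->
  (1 - t) * a + t * b = 0 -> a = 0.
Proof.
move=> t1 t0 a0 b0 e; have tb := mulr_ge0 t0 b0.
have ta : (1 - t) * a = 0 by have : 0 <= (1 - t) * a; [rewrite mulr_ge0; lra | lra].
by move/eqP: ta; rewrite mulf_eq0 => /orP[/eqP|/eqP//]; lra.
Qed.

Lemma cross_segment a b c d z : segment c d z ->
  exists t, [/\ 0 <= t, t <= 1, z = (c.1 + t * (d.1 - c.1), c.2 + t * (d.2 - c.2)) &
    cross a b z = (1 - t) * cross a b c + t * cross a b d].
Proof.
move=> [t [t0 t1 ->]]; exists t; split => //; exact: crossE.
Qed.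

Lemma convex_poly_open : convex_pt poly_open.
Proof.
move=> a b oa ob z /[swap] x /[swap] y xy; rewrite /=.
move=> Nxy; have [t [t0 t1 _ ->]] := cross_segment (P x) (P y) xy.
have := oa _ _ Nxy; have := ob _ _ Nxy; nra.
Qed.

Lemma convex_poly_closed : convex_pt poly_closed.
Proof.
move=> a b oa ob z /[swap] x /[swap] y xy; rewrite /=.
move=> Nxy; have [t [t0 t1 _ ->]] := cross_segment (P x) (P y) xy.
have := oa _ _ Nxy; have := ob _ _ Nxy; nra.
Qed.

Lemma closed_poly_closed : closed poly_closed.
Proof.
rewrite (_ : poly_closed =
  \bigcap_(p in [set p | N p.1 p.2]) (cross (P p.1) (P p.2) @^-1` [set u | 0 <= u])).
  apply: closed_bigI => p _; apply: closed_comp; last exact: closed_ge.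
  by move=> z _; exact: continuous_cross.
apply/seteqP; split => z; first by move=> cz [x y] /= /cz.
by move=> cz x y Nxy; exact: (cz (x, y)).
Qed.

(** The list [s] makes the intersection of open half-planes finite. *)
Lemma open_poly_open (s : seq (L * L)) :
  (forall x y, N x y -> (x, y) \in s) -> open poly_open.
Proof.
move=> sP.
rewrite (_ : poly_open =
  [set z | forall p, p \in s -> N p.1 p.2 -> 0 < cross (P p.1) (P p.2) z]); last first.
  apply/seteqP; split => z; first by move=> oz [x y] /= _ /oz.
  by move=> oz x y Nxy; exact: (oz (x, y) (sP _ _ Nxy)).
elim: s {sP} => [|p s IH].
  by rewrite (_ : [set _ | _] = setT); [exact: openT | apply/seteqP; split].
rewrite (_ : [set _ | _] =
  [set z | N p.1 p.2 -> 0 < cross (P p.1) (P p.2) z] `&`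
  [set z | forall p, p \in s -> N p.1 p.2 -> 0 < cross (P p.1) (P p.2) z]).
  apply: openI => //; have [Np|nNp] := boolP (N p.1 p.2); last first.
    by rewrite (_ : [set _ | _] = setT); [exact: openT | apply/seteqP; split].
  rewrite (_ : [set _ | _] = cross (P p.1) (P p.2) @^-1` [set u | 0 < u]).
    apply: open_comp; last exact: open_gt.
    by move=> z _; exact: continuous_cross.
  by apply/seteqP; split => z //= ->.
apply/seteqP; split => z /=.
  move=> oz; split; first by apply: oz; rewrite mem_head.
  by move=> r rs; apply: oz; rewrite in_cons rs orbT.
by move=> [oz1 oz2] r; rewrite in_cons => /orP[/eqP->//|/oz2].
Qed.

(** On the line of the edge, the half-plane of the preceding edge makes the parameter of [z]
    nonnegative and that of the following edge makes it at most 1. *)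
Lemma poly_tight x y z : poly_closed z -> N x y -> cross (P x) (P y) z = 0 ->
  segment (P x) (P y) z.
Proof.
move=> cz Nxy z0; have [Nirr pre suc pos] := PN.
have xy : x != y by apply: contraNneq (Nirr x) => {2}->.
have [x' Nx' x'y] := pre _ _ Nxy; have [y' Ny' y'x] := suc _ _ Nxy.
have yx' : y != x' by rewrite eq_sym.
have xy' : x != y' by rewrite eq_sym.
have c1 := pos _ _ _ _ Nx' Ny' yx' (_ : y != x); rewrite eq_sym in c1.
have {c1} c1 := c1 xy.
have c2 := pos _ _ _ _ Ny' Nxy xy xy'.
have h1 := cz _ _ Nx'; have h2 := cz _ _ Ny'.
pose s := cross (P x') (P x) z / cross (P x') (P x) (P y).
have sE : cross (P x') (P x) z = s * cross (P x') (P x) (P y).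
  by rewrite /s divfK ?gt_eqF.
have s0 : 0 <= s by rewrite /s divr_ge0 // ltW.
have e1 : z.1 = (P x).1 + s * ((P y).1 - (P x).1).
  apply: (mulIf (lt0r_neq0 c1)); rewrite mulrDl mulrAC -sE.
  transitivity ((P x).1 * cross (P x') (P x) (P y)
    + cross (P x') (P x) z * ((P y).1 - (P x).1)
    - ((P x).1 - (P x').1) * cross (P x) (P y) z).
    by rewrite /cross; ring.
  by rewrite z0 mulr0 subr0.
have e2 : z.2 = (P x).2 + s * ((P y).2 - (P x).2).
  apply: (mulIf (lt0r_neq0 c1)); rewrite mulrDl mulrAC -sE.
  transitivity ((P x).2 * cross (P x') (P x) (P y)
    + cross (P x') (P x) z * ((P y).2 - (P x).2)
    - ((P x).2 - (P x').2) * cross (P x) (P y) z).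
    by rewrite /cross; ring.
  by rewrite z0 mulr0 subr0.
have e3 : cross (P y) (P y') z = (1 - s) * cross (P y) (P y') (P x).
  by rewrite /cross e1 e2; ring.
exists s; split => //; first by move: h2; rewrite e3 pmulr_lge0 // subr_ge0.
by rewrite [LHS]surjective_pairing e1 e2.
Qed.

(** The functionals of the two edges at [P x] are nonnegative at [a] and [b] and vanish at [P x]. If
    this point is interior to the segment, both vanish at [a] as well, and the two lines meet only
    in [P x]. *)
Lemma poly_vertex_extreme x y : N x y -> extreme_pt poly_closed (P x).
Proof.
move=> Nxy a b ca cb ab sx; have [Nirr pre suc pos] := PN.
have xy : x != y by apply: contraNneq (Nirr x) => {2}->.
have [x' Nx' x'y] := pre _ _ Nxy; have [y' Ny' y'x] := suc _ _ Nxy.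
have c1 : 0 < cross (P x') (P x) (P y).
  by apply: pos Nx' Ny' _ _; rewrite eq_sym.
have [t [t0 t1 ex]] := sx.
have [tE|tn0] := eqVneq t 0.
  by left; rewrite ex tE !mul0r !addr0; case: (a).
have [tE|tn1] := eqVneq t 1.
  by right; rewrite ex tE !mul1r !subrKC; case: (b).
have {tn0} t0' : 0 < t by rewrite lt_neqAle eq_sym tn0.
have {tn1} t1' : t < 1 by rewrite lt_neqAle tn1.
have z1 : cross (P x) (P y) (P x) = 0 by rewrite /cross; ring.
have z2 : cross (P x') (P x) (P x) = 0 by rewrite /cross; ring.
have h1 : cross (P x) (P y) a = 0.
  apply: (convex_comb_eq0 t1' t0 (ca _ _ Nxy) (cb _ _ Nxy)).
  by rewrite -crossE -ex.
have h2 : cross (P x') (P x) a = 0.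
  apply: (convex_comb_eq0 t1' t0 (ca _ _ Nx') (cb _ _ Nx')).
  by rewrite -crossE -ex.
have pa : P x = a.
  rewrite [LHS]surjective_pairing [RHS]surjective_pairing.
  congr pair; apply: (mulIf (lt0r_neq0 c1)).
  - transitivity (a.1 * cross (P x') (P x) (P y)
      - cross (P x') (P x) a * ((P y).1 - (P x).1)
      + ((P x).1 - (P x').1) * cross (P x) (P y) a).
      by rewrite /cross; ring.
    by rewrite h1 h2; ring.
  - transitivity (a.2 * cross (P x') (P x) (P y)
      - cross (P x') (P x) a * ((P y).2 - (P x).2)
      + ((P x).2 - (P x').2) * cross (P x) (P y) a).
      by rewrite /cross; ring.
    by rewrite h1 h2; ring.
by left.
Qed.

Lemma poly_vertex_closed x y : N x y -> poly_closed (P x).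
Proof.
move=> Nxy; have [Nirr pre suc pos] := PN => u v Nuv.
have [->|xu] := eqVneq x u; first by rewrite /cross; nra.
have [->|xv] := eqVneq x v; first by rewrite /cross; nra.
exact/ltW/(pos _ _ _ _ Nuv Nxy).
Qed.

Lemma polygon_vertex_inj x y z w : N x y -> N z w -> P x = P z -> x = z.
Proof.
move=> Nxy Nzw Pxz; have [Nirr pre suc pos] := PN; apply/eqP.
apply: contraT => xz; have [zy|zy] := eqVneq z y.
  have [x' Nx' x'y] := pre _ _ Nxy.
  have := pos _ _ _ _ Nx' Nzw; rewrite zy eq_sym x'y -zy eq_sym xz => /(_ isT isT).
  by rewrite -Pxz /cross; nra.
have := pos _ _ _ _ Nxy Nzw; rewrite eq_sym xz zy => /(_ isT isT).
by rewrite -Pxz /cross; nra.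
Qed.

Lemma poly_edge_closed x y : N x y -> segment (P x) (P y) `<=` poly_closed.
Proof.
move=> Nxy; have [Nirr pre suc pos] := PN.
have [y' Ny' y'x] := suc _ _ Nxy.
by apply: convex_poly_closed; apply: poly_vertex_closed; eassumption.
Qed.

(** The line of the first edge supports the polygon, so the second edge can meet it only in one of
    its own ends, which must then be an end of the first edge. *)
Lemma poly_edges_meet x y z w q : N x y -> N z w -> (x, y) != (z, w) ->
  segment (P x) (P y) q -> segment (P z) (P w) q ->
  exists2 v, ((v == x) || (v == y)) && ((v == z) || (v == w)) & q = P v.
Proof.
move=> Nxy Nzw ne sxy szw; have [Nirr pre suc pos] := PN.
have [w' Nw' _] := suc _ _ Nzw.
have zw : z != w by apply: contraNneq (Nirr z) => {2}->.
have [t [t0 t1 qE cq]] := cross_segment (P x) (P y) szw.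
have cq0 : cross (P x) (P y) q = 0.
  by have [u [_ _ _ ->]] := cross_segment (P x) (P y) sxy; rewrite /cross; ring.
have nz u v : N u v -> u != x -> u != y -> 0 < cross (P x) (P y) (P u).
  exact: pos.
have cz := poly_vertex_closed Nzw Nxy; have cw := poly_vertex_closed Nw' Nxy.
rewrite cq0 in cq.
have qz : t = 0 -> q = P z.
  by move=> te; rewrite qE te !mul0r !addr0; case: (P z).
have qw : t = 1 -> q = P w.
  by move=> te; rewrite qE te !mul1r !subrKC; case: (P w).
have [zxy|] := boolP ((z == x) || (z == y)); last first.
  rewrite negb_or => /andP[zx zy]; have c := nz _ _ Nzw zx zy.
  have t1E : t = 1 by nra.
  exists w; last exact: qw.
  rewrite eqxx orbT andbT; apply: contraT; rewrite negb_or => /andP[wx wy].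
  by have := nz _ _ Nw' wx wy; nra.
have [wxy|] := boolP ((w == x) || (w == y)); last first.
  rewrite negb_or => /andP[wx wy]; have c := nz _ _ Nw' wx wy.
  exists z; first by rewrite eqxx zxy.
  by apply: qz; nra.
(* Only the reversed edge is left; the vertex following [y] would be strictly to the left of both
   orientations. *)
exfalso; move: zxy wxy zw ne Nzw => /orP[]/eqP-> /orP[]/eqP->; rewrite ?eqxx // => xy _ Nyx.
have [y' Ny' y'x] := suc _ _ Nxy.
have [v Nv _] := suc _ _ Ny'.
have yy' : y' != y by apply: contraNneq (Nirr y) => {2}<-.
have := pos _ _ _ _ Nxy Nv y'x yy'; have := pos _ _ _ _ Nyx Nv yy' y'x.
rewrite /cross; nra.
Qed.

End Polygon.

(** * Horizontal layout of the chords *)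

(* One side of the drawing: [A i] is the index of the end of chord [i] on this
   side, [X i] its abscissa divided by [K = 2k], [q i] the slope of the chord and
   [rho i] that of the ray issued from its end. The last inequality leaves room,
   up to height [k], for the bulge of the face. *)
Definition side_layout (m : nat) (A : nat -> nat) (X q rho : nat -> int) :=
  (forall i, (i <= m)%N -> rho i <= q i) /\
  forall i, (i < m)%N ->
    [/\ (A i <= A i.+1)%N,
        A i = A i.+1 -> X i = X i.+1 /\ rho i = rho i.+1 &
        (A i < A i.+1)%N ->
          [/\ X i < X i.+1, rho i = q i &
              q i - rho i.+1 <= 2 * (X i.+1 - X i) - 2 * ((A i.+1)%:Z - (A i)%:Z)]].

(* Built from right to left: a new face gets width [max t b] plus half of the
   drops [q 0 - rho 0] and [- q 0 - tau 0] at its right end, and the potential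
   [X m + Y m - rho 0 - tau 0] pays for this. *)
Lemma layout_exists (m : nat) (A B : nat -> nat) :
  (forall i, (i < m)%N ->
    [/\ (A i <= A i.+1)%N, (B i <= B i.+1)%N & (A i + B i < A i.+1 + B i.+1)%N]) ->
  exists X Y rho tau : nat -> int,
    [/\ side_layout m A X (fun i => X i - Y i) rho,
        side_layout m B Y (fun i => Y i - X i) tau,
        X 0%N = 0 /\ Y 0%N = 0,
        forall i, (i <= m)%N -> [/\ 0 <= X i <= X m, 0 <= Y i <= Y m,
                                    - Y m <= rho i & - X m <= tau i] &
        X m + Y m - rho 0%N - tau 0%N <=
          3 * ((A m)%:Z - (A 0%N)%:Z + (B m)%:Z - (B 0%N)%:Z)].
Proof.
elim: m A B => [|m IH] A B AB.
  exists (fun=> 0), (fun=> 0), (fun=> 0), (fun=> 0); split=> //; try by split.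
  lia.
have [] := IH (A \o succn) (B \o succn).
  by move=> i im; exact: AB.
move=> X' [Y' [rho' [tau' [[rq tX] [tq tY] [X0 Y0] bd pot]]]].
rewrite /= in rq tX tq tY bd pot.
have [A01 B01 AB01] := AB 0%N isT.
have [r0 t0] : rho' 0%N <= 0 /\ tau' 0%N <= 0.
  by have := rq 0%N isT; have := tq 0%N isT; lia.
have Xm i : (i <= m)%N -> 0 <= X' i <= X' m by case/bd.
have Ym i : (i <= m)%N -> 0 <= Y' i <= Y' m by case/bd.
have rm i : (i <= m)%N -> - Y' m <= rho' i by case/bd.
have tm i : (i <= m)%N -> - X' m <= tau' i by case/bd.
have [w [wa wb wx wy]] : exists w : int,
  [/\ (A 0%N < A 1%N)%N -> 0 < w /\ - rho' 0%N <= 2 * w - 2 * ((A 1%N)%:Z - (A 0%N)%:Z),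
      (B 0%N < B 1%N)%N -> 0 < w /\ - tau' 0%N <= 2 * w - 2 * ((B 1%N)%:Z - (B 0%N)%:Z),
      0 < w &
      w * (A 0%N < A 1%N)%N%:Z + w * (B 0%N < B 1%N)%N%:Z -
        (if (A 0%N < A 1%N)%N then 0 else rho' 0%N - w * (B 0%N < B 1%N)%N%:Z) -
        (if (B 0%N < B 1%N)%N then 0 else tau' 0%N - w * (A 0%N < A 1%N)%N%:Z)
      <= 3 * ((A 1%N)%:Z - (A 0%N)%:Z + (B 1%N)%:Z - (B 0%N)%:Z) - rho' 0%N - tau' 0%N].
  pose t := (A 1%N)%:Z - (A 0%N)%:Z; pose b := (B 1%N)%:Z - (B 0%N)%:Z.
  pose dt := if (A 0%N < A 1%N)%N then - rho' 0%N else 0.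
  pose db := if (B 0%N < B 1%N)%N then - tau' 0%N else 0.
  pose w0 := (if t <= b then b else t).
  (* Half of the drops is rounded up. The extra 1 in [2 * w] is absorbed by the constant 3 of the
     potential, since [2 * max t b + 1 <= 3 * (t + b)]. *)
  have [w [w1 w2]] : exists w : int, 2 * w0 + dt + db <= 2 * w /\ 2 * w <= 2 * w0 + dt + db + 1.
    by exists (w0 + ((dt + db + 1) %/ 2)%Z); lia.
  exists w; move: w1 w2; rewrite /w0 /dt /db /t /b.
  case: ltnP => hA; case: ltnP => hB; case: ifP => hh; split; rewrite ?mulr0 ?mulr1; lia.
(* A side without edges in the new face keeps its end, so it is not moved. Translating the old ends
   by [wX] and [wY] shears the old part: its [q] and [rho] both change by [wX - wY], its [tau] by
   the opposite, and the differences in [side_layout] survive. *)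
pose wX : int := w * (A 0%N < A 1%N)%N%:Z; pose wY : int := w * (B 0%N < B 1%N)%N%:Z.
pose r0' : int := if (A 0%N < A 1%N)%N then 0 else rho' 0%N - wY.
pose t0' : int := if (B 0%N < B 1%N)%N then 0 else tau' 0%N - wX.
exists (fun i => if i is j.+1 then X' j + wX else 0),
  (fun i => if i is j.+1 then Y' j + wY else 0),
  (fun i => if i is j.+1 then rho' j + wX - wY else r0'),
  (fun i => if i is j.+1 then tau' j + wY - wX else t0').
have wXY : [/\ 0 <= wX, 0 <= wY, wX <= w & wY <= w].
  by rewrite /wX /wY; case: ltnP => _; case: ltnP => _; split; lia.
have [wX0 wY0 wXw wYw] := wXY.
split.
- split.
  + case=> [|i] im; last by have := rq i im; lia.
    by rewrite /r0' subrr; case: ifP => //; lia.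
  + case=> [|i] im; last first.
      have [h1 h2 h3] := tX i im; split=> // e; first by have [-> ->] := h2 e.
      by have [? ? ?] := h3 e; split; lia.
    split=> // h.
      by rewrite X0 /r0' /wX h ltnn /=; split; lia.
    by have [? ?] := wa h; rewrite X0 ?Y0 /r0' h subrr; split => //; move: wXw; rewrite /wX h; lia.
- split.
  + case=> [|i] im; last by have := tq i im; lia.
    by rewrite /t0' subrr; case: ifP => //; lia.
  + case=> [|i] im; last first.
      have [h1 h2 h3] := tY i im; split=> // e; first by have [-> ->] := h2 e.
      by have [? ? ?] := h3 e; split; lia.
    split=> // h.
      by rewrite Y0 /t0' /wY h ltnn /=; split; lia.
    by have [? ?] := wb h; rewrite ?X0 Y0 /t0' h subrr; split => //; move: wYw; rewrite /wY h; lia.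
- by split.
- have m0 := leq0n m.
  have Xmm := Xm m (leqnn m); have Ymm := Ym m (leqnn m).
  have rm0 := rm 0%N m0; have tm0 := tm 0%N m0.
  case=> [|i] im.
    by rewrite /r0' /t0'; split; try case: ifP; lia.
  by have := Xm i im; have := Ym i im; have := rm i im; have := tm i im; split; lia.
- move: wy pot; rewrite /r0' /t0' /wX /wY.
  by case: ltnP => hA; case: ltnP => hB; rewrite ?mulr0 ?mulr1 /=; lia.
Qed.

(** * The bulge of a face *)

(* Here [h] is the height above the base of the bulge and [L] the horizontal
   distance to the left chord. The bulge goes through [(s ^+ 2, s)] for [s < t]
   and down to [(2 * k * w, 0)]; the lines of its edges are [rise_line s = 0], from
   [s] to [s + 1], and [fall_line = 0]. *)
Definition rise_line (s L h : RR) := L + s ^+ 2 + s - (2 * s + 1) * h.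
Definition fall_line (k t w L h : RR) :=
  (2 * k * w - L) * (t - 1) - (2 * k * w - (t - 1) ^+ 2) * h.

(** With [w] and [w'] the widths of the face on its own and on the opposite line, this is the
    distance from the bulge vertex [(s ^+ 2, s)] to the right chord. It is at least
    [2 * w * (k - s) + s * (2 * t - s)]. *)
Lemma side_room (k t w w' s : RR) :
  1 <= t -> t <= k -> 0 < w -> w' - w <= 2 * w - 2 * t ->
  0 <= s -> s <= t - 1 -> 0 < 2 * k * w + (w - w') * s - s ^+ 2.
Proof.
move=> t1 tk w0 ww s0 st; have h1 : 0 < w * (k - s) by apply: mulr_gt0; lra.
have h2 : 0 <= s * (2 * t - s) by apply: mulr_ge0; lra.
have h3 : 0 <= s * (2 * w - 2 * t - w' + w) by apply: mulr_ge0; [|move: ww]; lra.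
nra.
Qed.

Lemma rise_line_below s L h : 0 <= s -> 0 <= L -> h <= 0 -> 0 <= rise_line s L h.
Proof. rewrite /rise_line => *; nra. Qed.

Lemma rise_line_below_lt s L h : 0 <= s -> 0 <= L -> h < 0 -> 0 < rise_line s L h.
Proof. rewrite /rise_line => *; nra. Qed.

(** [fall_line] equals [t - 1] times the distance to the right chord plus [- h] times the room of
    [side_room] at [s = t - 1]. *)
Lemma fall_line_below (k t w w' L h : RR) :
  1 <= t -> t <= k -> 0 < w -> w' - w <= 2 * w - 2 * t ->
  L <= 2 * k * w + (w - w') * h -> h <= 0 ->
  0 <= fall_line k t w L h.
Proof.
move=> t1 tk w0 ww Lw h0.
have r := side_room t1 tk w0 ww (_ : 0 <= t - 1) (lexx _).
have {}r := r ltac:(lra).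
have h1 : 0 <= (2 * k * w + (w - w') * h - L) * (t - 1) by apply: mulr_ge0; lra.
have h2 : 0 <= (- h) * (2 * k * w + (w - w') * (t - 1) - (t - 1) ^+ 2).
  by apply: mulr_ge0; lra.
rewrite /fall_line; nra.
Qed.

Lemma fall_line_below_lt (k t w w' L h : RR) :
  1 <= t -> t <= k -> 0 < w -> w' - w <= 2 * w - 2 * t ->
  L <= 2 * k * w + (w - w') * h -> h < 0 ->
  0 < fall_line k t w L h.
Proof.
move=> t1 tk w0 ww Lw h0.
have r := side_room t1 tk w0 ww (_ : 0 <= t - 1) (lexx _).
have {}r := r ltac:(lra).
have h1 : 0 <= (2 * k * w + (w - w') * h - L) * (t - 1) by apply: mulr_ge0; lra.
have h2 : 0 < (- h) * (2 * k * w + (w - w') * (t - 1) - (t - 1) ^+ 2).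
  by apply: mulr_gt0; lra.
rewrite /fall_line; nra.
Qed.

Lemma fall_line_vertex (k t w s : RR) : 1 <= t -> t <= k -> 0 < w ->
  0 <= s -> s < t - 1 -> 0 < fall_line k t w (s ^+ 2) s.
Proof.
move=> t1 tk w0 s0 st.
have -> : fall_line k t w (s ^+ 2) s = (t - 1 - s) * (2 * k * w + (t - 1) * s).
  by rewrite /fall_line; ring.
have kw : 0 < k * w by apply: mulr_gt0; lra.
by apply: mulr_gt0; nra.
Qed.

(* Above its base, the bulge stays between the two rays bounding its sector. *)
Lemma bulge_zone (k t w w' d L h : RR) :
  1 <= t -> t <= k -> 0 < w -> w' - w <= 2 * w - 2 * t ->
  0 <= w' -> (t = 1 \/ 2 <= t) -> d <= 2 * w - 2 * t -> 0 < h ->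
  0 <= fall_line k t w L h ->
  (2 <= t -> 0 <= rise_line 0 L h) ->
  (2 <= t -> 0 <= rise_line (t - 2) L h) ->
  [/\ 0 < L, L < 2 * k * w - d * h & h < k].
Proof.
move=> t1 tk w0 ww w'0 [te|t2] dw h0 hf hr0 hr.
- exfalso; move: hf; rewrite /fall_line te !subrr => hf.
  have : 0 < h * (k * w) by apply: mulr_gt0; [|apply: mulr_gt0]; lra.
  lra.
have kw : 0 < (k - (t - 1)) * w by apply: mulr_gt0; lra.
have tt : 0 <= (t - 1) * (t + 1) by apply: mulr_ge0; lra.
(* The last bulge vertex [((t - 1) ^+ 2, t - 1)] is strictly left of the right ray even for the
   largest possible [d], namely [2 * w - 2 * t]. *)
have p : 0 < 2 * k * w - (t - 1) ^+ 2 - (t - 1) * (2 * w - 2 * t) by nra.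
have {}hr0 := hr0 t2; have {}hr := hr t2.
have p0 : 0 < 2 * k * w - (t - 1) ^+ 2.
  have : 0 <= (k - t) * w by apply: mulr_ge0; lra.
  have : 0 <= t * (3 * w - 2 * t) by apply: mulr_ge0; lra.
  nra.
(* Above the last bulge vertex, the last rising edge pushes the point to the right of that vertex,
   hence beyond [fall_line]. *)
have ht : h <= t - 1.
  apply/negP => /negP; rewrite -ltNge => ht.
  have L1 : (t - 1) ^+ 2 < L by move: hr; rewrite /rise_line; nra.
  have h1 : 0 < (2 * k * w - (t - 1) ^+ 2) * (h - (t - 1)) by apply: mulr_gt0; lra.
  have h2 : 0 < (L - (t - 1) ^+ 2) * (t - 1) by apply: mulr_gt0; lra.
  by move: hf; rewrite /fall_line; nra.
split; [by move: hr0; rewrite /rise_line expr0n /= mulr0 add0r mul1r !addr0 subr_ge0; apply: lt_le_trans | | lra].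
have h1 : 0 <= h * (2 * w - 2 * t - d) by apply: mulr_ge0; lra.
have h2 := mulr_gt0 h0 p.
have h3 : 0 < (t - 1) * (2 * k * w - L - (2 * w - 2 * t) * h).
  have -> : (t - 1) * (2 * k * w - L - (2 * w - 2 * t) * h) = fall_line k t w L h +
    h * (2 * k * w - (t - 1) ^+ 2 - (t - 1) * (2 * w - 2 * t)).
    by rewrite /fall_line; ring.
  by apply: ltr_wpDl.
rewrite pmulr_rgt0 in h3; lra.
Qed.

Local Notation "n %:r" := (n%:~R : RR) (at level 1, left associativity, format "n %:r").

(** If no face qualifies, [find] returns [m]: the last vertex [A m] belongs to the last chord. *)
Definition chord_index (m : nat) (A : nat -> nat) (a : nat) :=
  find (fun j => (a < A j.+1)%N) (iota 0 m).

(** The bulge vertex [(s ^+ 2, s)] with the shear undone. A face with edges on this side has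
    [rho i = q i], so [rho i] is indeed the slope of its left chord. *)
Definition side_point (m : nat) (A : nat -> nat) (K : int) (X rho : nat -> int)
    (a : nat) : int * int :=
  let i := chord_index m A a in
  let s := a%:Z - (A i)%:Z in
  (K * X i + s ^+ 2 + rho i * s, s).

Section Side.
Variables (m : nat) (A : nat -> nat) (X q rho : nat -> int).
Hypothesis AX : side_layout m A X q rho.

Lemma side_mono i j : (i <= j)%N -> (j <= m)%N -> (A i <= A j)%N.
Proof.
elim: j => [|j IH]; first by rewrite leqn0 => /eqP->.
rewrite leq_eqVlt => /orP[/eqP->//|ij] jm.
by apply: leq_trans (IH _ (ltnW jm)) _ => //; case: AX => _ /(_ j jm)[].
Qed.

Lemma side_const i j : (i <= j)%N -> (j <= m)%N -> A i = A j ->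
  X i = X j /\ rho i = rho j.
Proof.
elim: j => [|j IH]; first by rewrite leqn0 => /eqP->.
rewrite leq_eqVlt => /orP[/eqP->//|ij] jm Aij.
rewrite ltnS in ij; have h1 := side_mono ij (ltnW jm); have h2 := side_mono (leqnSn j) jm.
have e1 : A i = A j by lia.
have e2 : A j = A j.+1 by lia.
have [-> ->] := IH ij (ltnW jm) e1.
by case: AX => _ /(_ j jm)[_ /(_ e2)].
Qed.

Lemma chord_index_face i a : (i < m)%N -> (A i <= a)%N -> (a < A i.+1)%N ->
  chord_index m A a = i.
Proof.
move=> im ia ai; apply/eqP; rewrite eqn_leq; apply/andP; split.
  rewrite leqNgt; apply/negP => lt.
  by have := before_find 0%N lt; rewrite nth_iota // add0n ai.
rewrite leqNgt; apply/negP => lt.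
have hs : has (fun j => (a < A j.+1)%N) (iota 0 m).
  by apply/hasP; exists i => //; rewrite mem_iota.
have := nth_find 0%N hs; rewrite -/(chord_index m A a) nth_iota; last by lia.
rewrite add0n; have := side_mono lt (ltnW im); lia.
Qed.

Lemma side_point_face K i a : (i < m)%N -> (A i <= a)%N -> (a < A i.+1)%N ->
  side_point m A K X rho a =
  (K * X i + (a%:Z - (A i)%:Z) ^+ 2 + rho i * (a%:Z - (A i)%:Z), a%:Z - (A i)%:Z).
Proof. by move=> im ia ai; rewrite /side_point (chord_index_face im ia ai). Qed.

(** At the apex of a fan, [chord_index] picks the last chord of the fan; by [side_const] all chords
    of the fan have the same [X]. *)
Lemma side_point_chord K i : (i <= m)%N ->
  side_point m A K X rho (A i) = (K * X i, 0).
Proof.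
move=> im; set j := chord_index m A (A i).
have jm : (j <= m)%N by rewrite /j -[X in (_ <= X)%N](size_iota 0) find_size.
have [e ij] : A i = A j /\ ((i <= j) || (j <= i))%N.
  split; last exact: leq_total.
  move: jm; rewrite leq_eqVlt => /orP[/eqP je|jm].
    have hm : (A m <= A i)%N.
      case: (posnP m) => [m0|m0]; first by move: im; rewrite m0 leqn0 => /eqP->.
      have lt : (m.-1 < j)%N by lia.
      have := before_find 0%N lt; rewrite nth_iota; last by lia.
      by rewrite add0n prednK // => /negbT; rewrite -leqNgt.
    by have := side_mono im (leqnn m); rewrite je; lia.
  have hs : has (fun j => (A i < A j.+1)%N) (iota 0 m).
    by rewrite has_find size_iota.
  have := nth_find 0%N hs; rewrite -/(chord_index _ _ _) -/j nth_iota // add0n => h1.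
  have ij : (i <= j)%N.
    rewrite leqNgt; apply/negP => ji; have := side_mono ji im; lia.
  apply/eqP; rewrite eqn_leq (side_mono ij (ltnW jm)) /=.
  case: (posnP j) => [j0|j0]; first by rewrite j0 side_mono.
  have lt : (j.-1 < j)%N by lia.
  have := before_find 0%N lt; rewrite nth_iota; last by lia.
  by rewrite add0n prednK // => /negbT; rewrite -leqNgt.
rewrite /side_point -/j -e subrr expr0n /= !mulr0 !addr0.
by congr (_ * _, _); case/orP: ij => h; [rewrite (side_const h jm e).1|rewrite (side_const h im (esym e)).1].
Qed.

Lemma side_face_real i : (i < m)%N -> (A i < A i.+1)%N ->
  let t : RR := (A i.+1)%:R - (A i)%:R in
  let w := (X i.+1)%:r - (X i)%:r in
  [/\ 1 <= t, t = 1 \/ 2 <= t, 0 < w, rho i = q i &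
      (q i)%:r - (rho i.+1)%:r <= 2 * w - 2 * t].
Proof.
move=> im AA t w.
have [_ _ /(_ AA)[Xi ri qi]] := AX.2 i im.
have tE : t = ((A i.+1)%:Z - (A i)%:Z)%:r by rewrite /t rmorphB.
have t1 : 1 <= (A i.+1)%:Z - (A i)%:Z by lia.
split => //.
- by rewrite tE (ler_int RR 1).
- have [/eqP e|e] := boolP ((A i.+1)%:Z - (A i)%:Z == 1); first by left; rewrite tE e.
  right; rewrite tE (ler_int RR 2); lia.
- by rewrite subr_gt0 ltr_int.
- have := qi; rewrite -(ler_int RR) !rmorphB !rmorphM /= !rmorphB /=.
  by rewrite /w /t; lra.
Qed.

Lemma side_rho_le i : (i <= m)%N -> (rho i)%:r <= (q i)%:r.
Proof. by move=> im; rewrite ler_int; exact: AX.1. Qed.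

Lemma side_X_le i : (i < m)%N -> (X i)%:r <= (X i.+1)%:r.
Proof.
move=> im; rewrite ler_int; have [h1 h2 h3] := AX.2 i im.
move: h1; rewrite leq_eqVlt => /orP[/eqP/h2[-> _]//|/h3[/ltW]//].
Qed.

Lemma side_X_mono i j : (i <= j)%N -> (j <= m)%N ->
  X i <= X j /\ ((A i < A j)%N -> X i < X j).
Proof.
elim: j => [|j IH]; first by rewrite leqn0 => /eqP->; rewrite ltnn.
rewrite leq_eqVlt => /orP[/eqP->|]; first by rewrite ltnn.
rewrite ltnS => ij jm; have [h1 h2] := IH ij (ltnW jm).
have [Aj e lt] := AX.2 j jm; move: Aj; rewrite leq_eqVlt => /orP[/eqP AA|AA].
  by have [<- _] := e AA; rewrite -AA.
have [Xj _ _] := lt AA.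
by split=> [|_]; [apply: le_trans (ltW Xj) | apply: le_lt_trans Xj].
Qed.

(** [L] and [R] are the horizontal distances at height [h] to the lines of the left and right
    chords. The right end is treated apart because its coordinates are computed from a later
    chord. *)
Lemma side_vertex (k i a : nat) : (i < m)%N -> (A i <= a <= A i.+1)%N ->
  (A i.+1 - A i <= k)%N ->
  let p := side_point m A (2 * k%:Z) X rho a in
  let h := p.2%:r in
  let L := p.1%:r - 2 * k%:R * (X i)%:r - (q i)%:r * h in
  let w := (X i.+1)%:r - (X i)%:r in
  let R := 2 * k%:R * w + ((q i.+1)%:r - (q i)%:r) * h - L in
  [/\ (a < A i.+1)%N -> h = a%:R - (A i)%:R /\ L = h ^+ 2,
      a = A i.+1 -> h = 0 /\ L = 2 * k%:R * w,
      [/\ 0 <= h, 0 <= L & 0 <= R],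
      a != A i -> 0 < L &
      a != A i.+1 -> 0 < R].
Proof.
move=> im /andP[Aa aA] tk p h L w R.
have k0 : 0 <= (k%:R : RR) by rewrite ler0n.
have Xw : 0 <= w by rewrite subr_ge0 side_X_le.
have c1 : (a < A i.+1)%N -> h = a%:R - (A i)%:R /\ L = h ^+ 2.
  move=> lt; have AA : (A i < A i.+1)%N by lia.
  have [_ _ _ re _] := side_face_real im AA.
  have pE : p = _ := side_point_face _ im Aa lt.
  have hE : h = a%:R - (A i)%:R by rewrite /h pE /= rmorphB.
  split => //; rewrite /L hE pE /= re !rmorphD !rmorphM /= !rmorphB /= expr2; ring.
have c2 : a = A i.+1 -> h = 0 /\ L = 2 * k%:R * w.
  move=> e; have pE : p = (2 * k%:Z * X i.+1, 0) by rewrite /p e side_point_chord.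
  have hE : h = 0 by rewrite /h pE.
  split => //; rewrite /L hE pE /w /= !rmorphM /=; ring.
move: aA; rewrite leq_eqVlt => /orP[/eqP ae|lt]; last first.
  have AA : (A i < A i.+1)%N by lia.
  have [t1 t12 w0 re qr] := side_face_real im AA.
  have [hE LE] := c1 lt.
  have tk' : ((A i.+1)%:R - (A i)%:R : RR) <= k%:R.
    by rewrite -natrB ?ler_nat // ltnW.
  have s0 : 0 <= h by rewrite hE subr_ge0 ler_nat.
  have st : h <= (A i.+1)%:R - (A i)%:R - 1.
    by rewrite hE; have : ((a.+1)%:R : RR) <= (A i.+1)%:R; [rewrite ler_nat | rewrite -natr1; lra].
  have rq := side_rho_le im.
  have ww : w + ((q i)%:r - (q i.+1)%:r) - w <= 2 * w - 2 * ((A i.+1)%:R - (A i)%:R) by rewrite /w; lra.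
  have R0 : 0 < R.
    have := side_room t1 tk' w0 ww s0 st; congr (0 < _).
    by rewrite /R LE /w; ring.
  split => //.
  - by split; rewrite ?LE ?sqr_ge0 // ltW.
  - move=> ne; have ltA : (A i < a)%N by rewrite ltn_neqAle eq_sym ne.
    have h0 : 0 < h by rewrite hE subr_gt0 ltr_nat.
    by rewrite LE exprn_gt0.
have [hE LE] := c2 ae.
have L0 : 0 <= L by rewrite LE; apply: mulr_ge0 => //; lra.
split => //.
- by split => //; rewrite ?hE // /R LE hE; lra.
- move=> ne; have AA : (A i < A i.+1)%N by rewrite -ae ltn_neqAle eq_sym ne.
  have [t1 t12 w0 re qr] := side_face_real im AA.
  have kp : (0 < k)%N by apply: leq_trans tk; rewrite subn_gt0.
  have k1 : 0 < (k%:R : RR) by rewrite ltr0n.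
  by rewrite LE; apply: mulr_gt0 => //; apply: mulr_gt0.
- by rewrite ae eqxx.
Qed.

Definition edge_line (k i a : nat) (L h : RR) : RR :=
  if (a.+1 < A i.+1)%N then rise_line (a%:R - (A i)%:R) L h
  else fall_line k%:R ((A i.+1)%:R - (A i)%:R) ((X i.+1)%:r - (X i)%:r) L h.

Section Edges.
Variables (k i a : nat).
Hypotheses (im : (i < m)%N) (tk : (A i.+1 - A i <= k)%N).
Hypotheses (Aa : (A i <= a)%N) (aA : (a < A i.+1)%N).
Let w : RR := (X i.+1)%:r - (X i)%:r.

Lemma side_edge_hyps : let t : RR := (A i.+1)%:R - (A i)%:R in
  let w' := w + ((q i)%:r - (q i.+1)%:r) in
  [/\ 1 <= t, t <= k%:R, 0 < w, w' - w <= 2 * w - 2 * t & 0 <= (a%:R - (A i)%:R : RR)].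
Proof.
move=> t w'; have AA : (A i < A i.+1)%N by apply: leq_trans aA.
have [t1 t12 w0 re qr] := side_face_real im AA.
have rq := side_rho_le im.
split => //.
- by rewrite /t -natrB ?ler_nat // ltnW.
- by rewrite /w' /w /t; lra.
- by rewrite subr_ge0 ler_nat.
Qed.

Lemma edge_line_below L h : 0 <= L ->
  0 <= 2 * k%:R * w + ((q i.+1)%:r - (q i)%:r) * h - L -> h <= 0 ->
  0 <= edge_line k i a L h.
Proof.
have [t1 tk' w0 ww s0] := side_edge_hyps; move=> L0 R0 h0; rewrite /edge_line.
case: ifP => _; first exact: rise_line_below.
apply: (fall_line_below t1 tk' w0 ww) => //.
by move: R0; rewrite -/w; lra.
Qed.

Lemma edge_line_below_lt L h : 0 <= L ->
  0 <= 2 * k%:R * w + ((q i.+1)%:r - (q i)%:r) * h - L -> h < 0 ->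
  0 < edge_line k i a L h.
Proof.
have [t1 tk' w0 ww s0] := side_edge_hyps; move=> L0 R0 h0; rewrite /edge_line.
case: ifP => _; first exact: rise_line_below_lt.
apply: (fall_line_below_lt t1 tk' w0 ww) => //.
by move: R0; rewrite -/w; lra.
Qed.

(** This is why a parabola is used: at vertex [a'] the line of the rising edge from [a] to [a.+1]
    takes the value [(a' - a) * (a' - a - 1)], positive for every other integer. *)
Lemma edge_line_vertex (a' : nat) L h : (A i <= a' <= A i.+1)%N ->
  a' != a -> a' != a.+1 ->
  ((a' < A i.+1)%N -> h = a'%:R - (A i)%:R /\ L = h ^+ 2) ->
  (a' = A i.+1 -> h = 0 /\ L = 2 * k%:R * w) ->
  0 < edge_line k i a L h.
Proof.
move=> /andP[Aa' aA'] na na1 c1 c2; have [t1 tk' w0 ww s0] := side_edge_hyps.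
have k0 : 0 < (k%:R : RR) by lra.
have kw : 0 < k%:R * w by apply: mulr_gt0.
rewrite /edge_line; case: ifP => lt.
  move: aA'; rewrite leq_eqVlt => /orP[/eqP/c2[-> ->]|/c1[-> ->]].
    rewrite /rise_line mulr0 subr0 -addrA; apply: ltr_pwDl; first by lra.
    by rewrite addr_ge0 ?sqr_ge0.
  have -> : rise_line (a%:R - (A i)%:R) ((a'%:R - (A i)%:R) ^+ 2) (a'%:R - (A i)%:R) =
    (a'%:R - a%:R) * (a'%:R - (a%:R + 1)) :> RR by rewrite /rise_line; ring.
  rewrite natr1; have [aa|aa] := ltnP a a'.
    by apply: mulr_gt0; rewrite subr_gt0 ltr_nat; lia.
  by rewrite nmulr_rgt0 subr_lt0 ltr_nat; lia.
have a1 : a.+1 = A i.+1 by lia.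
have lt' : (a' < a)%N by lia.
have [|hE ->] := c1; first by lia.
rewrite hE; apply: fall_line_vertex => //.
  by rewrite subr_ge0 ler_nat.
by rewrite -a1 -natr1; have : (a'%:R < a%:R :> RR); [rewrite ltr_nat | lra].
Qed.

End Edges.

(** With [w] and [t] the width and the number of edges of the face, the gap at height [h] is at
    least [2 * w * (k - h) + 2 * t * h]. *)
Lemma side_ray_le (k : nat) i (h : RR) : (i < m)%N -> 0 <= h -> h <= k%:R ->
  2 * k%:R * (X i)%:r + (rho i)%:r * h <=
  2 * k%:R * (X i.+1)%:r + (rho i.+1)%:r * h.
Proof.
move=> im h0 hk; have [Ai e _] := AX.2 i im.
move: Ai; rewrite leq_eqVlt => /orP[/eqP/e[-> ->]//|AA].
have [t1 _ w0 re qr] := side_face_real im AA; rewrite re.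
have h1 : 0 <= ((X i.+1)%:r - (X i)%:r) * (k%:R - h) by apply: mulr_ge0; lra.
have h2 : 0 <= h * (2 * ((X i.+1)%:r - (X i)%:r) - 2 * ((A i.+1)%:R - (A i)%:R)
   - ((q i)%:r - (rho i.+1)%:r)) by apply: mulr_ge0; lra.
have h3 : 0 <= ((A i.+1)%:R - (A i)%:R) * h by apply: mulr_ge0; lra.
lra.
Qed.

Lemma side_zone (k : nat) i (L h : RR) : (i < m)%N -> (A i < A i.+1)%N ->
  (A i.+1 - A i <= k)%N ->
  0 <= (X i.+1)%:r - (X i)%:r + ((q i)%:r - (q i.+1)%:r) -> 0 < h ->
  (forall a, (A i <= a)%N -> (a < A i.+1)%N -> 0 <= edge_line k i a L h) ->
  [/\ 0 < L,
      L < 2 * k%:R * ((X i.+1)%:r - (X i)%:r) - ((q i)%:r - (rho i.+1)%:r) * h &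
      h < k%:R].
Proof.
move=> im AA Ak w'0 h0 he.
have e1 : ((A i.+1).-1).+1 = A i.+1 by rewrite prednK //; lia.
have a1 : (A i <= (A i.+1).-1)%N by lia.
have a2 : ((A i).+1 < A i.+1)%N ->
  [/\ ((A i.+1 - 2).+1 < A i.+1)%N, (2 <= A i.+1)%N, (A i <= A i.+1 - 2)%N &
      (A i.+1 - 2 < A i.+1)%N] by clear; split; lia.
have [t1 tk' w0 ww _] := side_edge_hyps im Ak (leqnn _) AA.
have [_ t12 _ re qr] := side_face_real im AA.
have t2 : 2 <= (A i.+1)%:R - (A i)%:R :> RR -> ((A i).+1 < A i.+1)%N.
  by move=> t2; rewrite -(ltr_nat RR) -natr1; lra.
apply: (bulge_zone t1 tk' w0 ww w'0 t12 qr h0).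
- have := he (A i.+1).-1 a1; rewrite /edge_line e1 ltnn; exact.
- by move=> /t2 lt; have := he (A i) (leqnn _) AA; rewrite /edge_line lt subrr.
- move=> /t2/a2[b1 b2 b3 b4]; have := he (A i.+1 - 2)%N b3 b4.
  by rewrite /edge_line b1 natrB // addrAC.
Qed.

End Side.

(** * The drawing of a strip of faces *)

(* [(true, a)] is top vertex number [a] and [(false, b)] is bottom vertex number
   [b], both counted from the left. *)
Definition lab := (bool * nat)%type.

Lemma lab_neqE (u v : bool) (a b : nat) :
  ((u, a) != (v, b) :> lab) = (u != v) || (a != b).
Proof. by rewrite -negb_and. Qed.

Ltac lab_lia := rewrite /= ?lab_neqE; lia.

(* The edges of face [i], oriented counterclockwise. *)
Definition face_edge (A B : nat -> nat) (i : nat) : rel lab := fun l l' =>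
  match l, l' with
  | (false, b), (false, b') => [&& b' == b.+1, B i <= b & b < B i.+1]%N
  | (false, b), (true, a) => (b == B i.+1) && (a == A i.+1)
  | (true, a), (true, a') => [&& a == a'.+1, A i <= a' & a' < A i.+1]%N
  | (true, a), (false, b) => (a == A i) && (b == B i)
  end.

Definition lab_point (m k : nat) (A B : nat -> nat) (X Y rho tau : nat -> int)
    (l : lab) : int * int :=
  if l.1 then let p := side_point m A (2 * k%:Z) X rho l.2 in (p.1, 2 * k%:Z + p.2)
  else let p := side_point m B (2 * k%:Z) Y tau l.2 in (p.1, - p.2).

Section Drawing.
Variables (m k : nat) (A B : nat -> nat) (X Y rho tau : nat -> int).
Hypothesis AX : side_layout m A X (fun i => X i - Y i) rho.
Hypothesis BY : side_layout m B Y (fun i => Y i - X i) tau.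
Hypothesis AB : forall i, (i < m)%N -> (A i + B i < A i.+1 + B i.+1)%N.
Hypothesis Ak : forall i, (i < m)%N -> (A i.+1 - A i <= k)%N.
Hypothesis Bk : forall i, (i < m)%N -> (B i.+1 - B i <= k)%N.

Definition lab_pt (l : lab) : plane :=
  to_point (lab_point m k A B X Y rho tau l).

Let x i : RR := (X i)%:r.
Let y i : RR := (Y i)%:r.

(* The horizontal distance from [z] to the line through chord [i]. *)
Definition chord_side (i : nat) (z : plane) : RR :=
  z.1 - 2 * k%:R * y i - (x i - y i) * z.2.
Definition above (z : plane) : RR := z.2 - 2 * k%:R.
Definition below (z : plane) : RR := - z.2.

Lemma A_le i : (i < m)%N -> (A i <= A i.+1)%N.
Proof. by move=> im; case: (AX.2 i im). Qed.

Lemma B_le i : (i < m)%N -> (B i <= B i.+1)%N.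
Proof. by move=> im; case: (BY.2 i im). Qed.

Lemma k_gt0 i : (i < m)%N -> (0 < k)%N.
Proof.
by move=> im; have := AB im; have := Ak im; have := Bk im; lia.
Qed.

Lemma kR_gt0 i : (i < m)%N -> 0 < k%:R :> RR.
Proof. by move/k_gt0; rewrite ltr0n. Qed.

Lemma chord_side_diff i z : chord_side i.+1 z = chord_side i z -
  (2 * k%:R * (x i.+1 - x i) + ((x i.+1 - y i.+1) - (x i - y i)) * above z).
Proof. rewrite /chord_side /above; ring. Qed.

Lemma chord_side_diffb i z : chord_side i.+1 z = chord_side i z -
  (2 * k%:R * (y i.+1 - y i) + ((y i.+1 - x i.+1) - (y i - x i)) * below z).
Proof. rewrite /chord_side /below; ring. Qed.

Lemma top_vertex i a (z := lab_pt (true, a)) : (i < m)%N ->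
  (A i <= a <= A i.+1)%N ->
  [/\ (a < A i.+1)%N -> above z = a%:R - (A i)%:R /\ chord_side i z = above z ^+ 2,
      a = A i.+1 -> above z = 0 /\ chord_side i z = 2 * k%:R * (x i.+1 - x i),
      [/\ 0 <= above z, 0 <= chord_side i z & chord_side i.+1 z <= 0],
      a != A i -> 0 < chord_side i z &
      a != A i.+1 -> chord_side i.+1 z < 0].
Proof.
move=> im ia; have [] := side_vertex AX im ia (Ak im).
set p := side_point _ _ _ _ _ _.
have zE : z = (p.1%:r, 2 * k%:R + p.2%:r).
  congr pair; transitivity ((2 * k%:Z + p.2)%:r) => //.
  by rewrite rmorphD rmorphM.
have hE : above z = p.2%:r by rewrite zE /above /= addrC addKr.
have LE : p.1%:r - 2 * k%:R * (X i)%:r - (X i - Y i)%:r * p.2%:r = chord_side i z.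
  by rewrite zE /chord_side /= /x /y rmorphB /=; ring.
rewrite LE -hE.
have RE : 2 * k%:R * ((X i.+1)%:r - (X i)%:r) +
    ((X i.+1 - Y i.+1)%:r - (X i - Y i)%:r) * above z - chord_side i z =
  - chord_side i.+1 z.
  by rewrite chord_side_diff /x /y !rmorphB /=; ring.
rewrite RE => c1 c2 [h0 L0 R0] c4 c5; split => //.
  by split => //; rewrite -oppr_ge0.
by move=> /c5; rewrite oppr_gt0.
Qed.

Lemma bot_vertex i b (z := lab_pt (false, b)) : (i < m)%N ->
  (B i <= b <= B i.+1)%N ->
  [/\ (b < B i.+1)%N -> below z = b%:R - (B i)%:R /\ chord_side i z = below z ^+ 2,
      b = B i.+1 -> below z = 0 /\ chord_side i z = 2 * k%:R * (y i.+1 - y i),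
      [/\ 0 <= below z, 0 <= chord_side i z & chord_side i.+1 z <= 0],
      b != B i -> 0 < chord_side i z &
      b != B i.+1 -> chord_side i.+1 z < 0].
Proof.
move=> im ib; have [] := side_vertex BY im ib (Bk im).
set p := side_point _ _ _ _ _ _.
have zE : z = (p.1%:r, - p.2%:r).
  congr pair; transitivity ((- p.2)%:r) => //.
  by rewrite rmorphN.
have hE : below z = p.2%:r by rewrite zE /below /= opprK.
have LE : p.1%:r - 2 * k%:R * (Y i)%:r - (Y i - X i)%:r * p.2%:r = chord_side i z.
  by rewrite zE /chord_side /= /x /y rmorphB /=; ring.
rewrite LE -hE.
have RE : 2 * k%:R * ((Y i.+1)%:r - (Y i)%:r) +
    ((Y i.+1 - X i.+1)%:r - (Y i - X i)%:r) * below z - chord_side i z =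
  - chord_side i.+1 z.
  by rewrite chord_side_diffb /x /y !rmorphB /=; ring.
rewrite RE => c1 c2 [h0 L0 R0] c4 c5; split => //.
  by split => //; rewrite -oppr_ge0.
by move=> /c5; rewrite oppr_gt0.
Qed.

Lemma chord_top i : (i <= m)%N -> lab_pt (true, A i) = (2 * k%:R * x i, 2 * k%:R).
Proof.
move=> im; rewrite /lab_pt /lab_point (side_point_chord AX _ im) /to_point /=.
by rewrite addr0 !rmorphM.
Qed.

Lemma chord_bot i : (i <= m)%N -> lab_pt (false, B i) = (2 * k%:R * y i, 0).
Proof.
move=> im; rewrite /lab_pt /lab_point (side_point_chord BY _ im) /to_point /=.
by rewrite oppr0 !rmorphM.
Qed.

Lemma cross_left i z : (i <= m)%N ->
  cross (lab_pt (true, A i)) (lab_pt (false, B i)) z = 2 * k%:R * chord_side i z.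
Proof.
by move=> im; rewrite chord_top // chord_bot // /cross /chord_side /=; ring.
Qed.

Lemma cross_right i z : (i <= m)%N ->
  cross (lab_pt (false, B i)) (lab_pt (true, A i)) z = - (2 * k%:R * chord_side i z).
Proof.
by move=> im; rewrite chord_top // chord_bot // /cross /chord_side /=; ring.
Qed.

(** The shear that makes chord [i] vertical preserves oriented areas. For [cross_below] a reflection
    is added, which reverses the orientation. *)
Lemma cross_above i u v z : cross u v z =
  (chord_side i v - chord_side i u) * (above z - above u) -
  (above v - above u) * (chord_side i z - chord_side i u).
Proof. rewrite /cross /chord_side /above; ring. Qed.

Lemma cross_below i u v z : cross u v z =
  (chord_side i u - chord_side i v) * (below z - below u) -
  (below u - below v) * (chord_side i z - chord_side i u).
Proof. rewrite /cross /chord_side /below; ring. Qed.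

Lemma cross_top i a z : (i < m)%N -> (A i <= a)%N -> (a < A i.+1)%N ->
  cross (lab_pt (true, a.+1)) (lab_pt (true, a)) z =
  edge_line A X k i a (chord_side i z) (above z).
Proof.
move=> im ia ai; rewrite (cross_above i).
have [c1 _ _ _ _] := @top_vertex i a im ltac:(lia).
have [d1 d2 _ _ _] := @top_vertex i a.+1 im ltac:(lia).
have [-> ->] := c1 ai; rewrite /edge_line; case: ifP => lt.
  have [-> ->] := d1 lt; rewrite -natr1 /rise_line; ring.
have e : a.+1 = A i.+1 by lia.
have [-> ->] := d2 e; rewrite -e -natr1 /fall_line /x; ring.
Qed.

Lemma cross_bot i b z : (i < m)%N -> (B i <= b)%N -> (b < B i.+1)%N ->
  cross (lab_pt (false, b)) (lab_pt (false, b.+1)) z =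
  edge_line B Y k i b (chord_side i z) (below z).
Proof.
move=> im ib bi; rewrite (cross_below i).
have [c1 _ _ _ _] := @bot_vertex i b im ltac:(lia).
have [d1 d2 _ _ _] := @bot_vertex i b.+1 im ltac:(lia).
have [-> ->] := c1 bi; rewrite /edge_line; case: ifP => lt.
  have [-> ->] := d1 lt; rewrite -natr1 /rise_line; ring.
have e : b.+1 = B i.+1 by lia.
have [-> ->] := d2 e; rewrite -e -natr1 /fall_line /y; ring.
Qed.

Lemma edge_top_below i a z : (i < m)%N -> (A i <= a)%N -> (a < A i.+1)%N ->
  0 <= chord_side i z -> chord_side i.+1 z <= 0 -> above z < 0 ->
  0 < edge_line A X k i a (chord_side i z) (above z).
Proof.
move=> im ia ai L0 R0 h0; apply: (edge_line_below_lt AX im (Ak im)) => //.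
by move: R0; rewrite chord_side_diff !rmorphB /= /x /y; lra.
Qed.

Lemma edge_bot_below i b z : (i < m)%N -> (B i <= b)%N -> (b < B i.+1)%N ->
  0 <= chord_side i z -> chord_side i.+1 z <= 0 -> below z < 0 ->
  0 < edge_line B Y k i b (chord_side i z) (below z).
Proof.
move=> im ib bi L0 R0 h0; apply: (edge_line_below_lt BY im (Bk im)) => //.
by move: R0; rewrite chord_side_diffb !rmorphB /= /x /y; lra.
Qed.

(** * Faces as convex polygons *)

Definition face_mem (i : nat) (l : lab) :=
  if l.1 then (A i <= l.2 <= A i.+1)%N else (B i <= l.2 <= B i.+1)%N.

Lemma face_edge_mem i l l' : (i < m)%N -> face_edge A B i l l' ->
  face_mem i l /\ face_mem i l'.
Proof.
move=> im; have := A_le im; have := B_le im.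
by case: l => [[] a]; case: l' => [[] b] /=; rewrite /face_mem /=; lia.
Qed.

Lemma face_edge_next i l : (i < m)%N -> face_mem i l -> exists l', face_edge A B i l l'.
Proof.
move=> im; case: l => [[] a]; rewrite /face_mem /= => h.
  have [e|e] := eqVneq a (A i); first by exists (false, B i); rewrite /= ?e !eqxx.
  by exists (true, a.-1); rewrite /=; lia.
have [e|e] := eqVneq a (B i.+1); first by exists (true, A i.+1); rewrite /= ?e !eqxx.
by exists (false, a.+1); rewrite /=; lia.
Qed.

Lemma face_ccw i : (i < m)%N -> ccw_polygon lab_pt (face_edge A B i).
Proof.
move=> im; have Ai := A_le im; have Bi := B_le im; have ABi := AB im.
have k0 := kR_gt0 im.
split.
- by case=> [[] a] /=; lia.
- move=> [[] a] [[] b] /= h.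
  + have [e|e] := eqVneq a (A i.+1).
      by exists (false, B i.+1); lab_lia.
    by exists (true, a.+1); lab_lia.
  + have [e|e] := eqVneq a (A i.+1).
      by exists (false, B i.+1); lab_lia.
    by exists (true, a.+1); lab_lia.
  + have [e|e] := eqVneq a (B i).
      by exists (true, A i); lab_lia.
    by exists (false, a.-1); lab_lia.
  + have [e|e] := eqVneq a (B i).
      by exists (true, A i); lab_lia.
    by exists (false, a.-1); lab_lia.
- move=> [[] b] [[] a] /= h.
  + have [e|e] := eqVneq a (A i).
      by exists (false, B i); lab_lia.
    by exists (true, a.-1); lab_lia.
  + have [e|e] := eqVneq a (B i.+1).
      by exists (true, A i.+1); lab_lia.
    by exists (false, a.+1); lab_lia.
  + have [e|e] := eqVneq a (A i).
      by exists (false, B i); lab_lia.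
    by exists (true, a.-1); lab_lia.
  + have [e|e] := eqVneq a (B i.+1).
      by exists (true, A i.+1); lab_lia.
    by exists (false, a.+1); lab_lia.
(* A vertex is tested against edges of its own side by [edge_line_vertex], against chords by its
   distance to them, and against edges of the opposite side by lying strictly on the inner side of
   their base line. *)
move=> l l' v w Nll' Nvw vl vl'.
have [vm _] := face_edge_mem im Nvw.
have ab v' : above v' = - 2 * k%:R - below v' by rewrite /above /below; ring.
have ba v' : below v' = - 2 * k%:R - above v' by rewrite /above /below; ring.
case: v vm vl vl' {Nvw w} => [[] c]; rewrite /face_mem /= => vm.
- have [c1 c2 [h0 L0 R0] L1 R1] := top_vertex im vm.
  case: l l' Nll' => [[] a] [[] b] /=; rewrite ?lab_neqE /=.
  + move=> /and3P[/eqP-> ia ai] n1 n2; rewrite (cross_top _ im ia ai).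
    exact: (edge_line_vertex AX im (Ak im) ia ai vm n2 n1 c1 c2).
  + move=> /andP[/eqP-> /eqP->] n1 n2; rewrite cross_left 1?ltnW //.
    by apply: mulr_gt0; [lra | exact: L1].
  + move=> /andP[/eqP-> /eqP->] n1 n2; rewrite cross_right // oppr_gt0.
    by rewrite pmulr_rlt0; [exact: R1 | lra].
  + move=> /and3P[/eqP-> ib bi] n1 n2; rewrite (cross_bot _ im ib bi).
    by apply: edge_bot_below => //; rewrite ba; lra.
- have [c1 c2 [h0 L0 R0] L1 R1] := bot_vertex im vm.
  case: l l' Nll' => [[] a] [[] b] /=; rewrite ?lab_neqE /=.
  + move=> /and3P[/eqP-> ia ai] n1 n2; rewrite (cross_top _ im ia ai).
    by apply: edge_top_below => //; rewrite ab; lra.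
  + move=> /andP[/eqP-> /eqP->] n1 n2; rewrite cross_left 1?ltnW //.
    by apply: mulr_gt0; [lra | exact: L1].
  + move=> /andP[/eqP-> /eqP->] n1 n2; rewrite cross_right // oppr_gt0.
    by rewrite pmulr_rlt0; [exact: R1 | lra].
  + move=> /and3P[/eqP-> ib bi] n1 n2; rewrite (cross_bot _ im ib bi).
    exact: (edge_line_vertex BY im (Bk im) ib bi vm n1 n2 c1 c2).
Qed.

(** * Sectors separating the faces *)

(* The abscissa at height [u] of the curve made of chord [i], of the ray above
   its top end and of the ray below its bottom end. *)
Definition sector (i : nat) (u : RR) : RR :=
  if 2 * k%:R < u then 2 * k%:R * x i + (rho i)%:r * (u - 2 * k%:R)
  else if u < 0 then 2 * k%:R * y i - (tau i)%:r * u
  else 2 * k%:R * y i + (x i - y i) * u.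

Lemma sector_mid i u : 0 <= u -> u <= 2 * k%:R ->
  sector i u = 2 * k%:R * y i + (x i - y i) * u.
Proof. by move=> u0 uk; rewrite /sector ltNge uk /= ltNge u0. Qed.

Lemma sector_top i u : 2 * k%:R <= u ->
  sector i u = 2 * k%:R * x i + (rho i)%:r * (u - 2 * k%:R).
Proof.
rewrite le_eqVlt => /orP[/eqP<-|h]; last by rewrite /sector h.
rewrite sector_mid // ?mulr_ge0 //; ring.
Qed.

Lemma sector_bot i u : u <= 0 ->
  sector i u = 2 * k%:R * y i + (tau i)%:r * (- u).
Proof.
have k0 : 0 <= 2 * k%:R :> RR by rewrite mulr_ge0.
rewrite le_eqVlt => /orP[/eqP->|h]; first by rewrite sector_mid //; ring.
rewrite /sector h ltNge (le_trans (ltW h) k0) /=; ring.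
Qed.

Lemma sector_leS i u : (i < m)%N -> - k%:R <= u -> u <= 3 * k%:R ->
  sector i u <= sector i.+1 u.
Proof.
move=> im uk ku; have k0 := kR_gt0 im.
have [u1|u1] := leP (2 * k%:R) u.
  rewrite !sector_top //.
  by apply: (side_ray_le AX im); lra.
have [u0|u0] := leP u 0.
  by rewrite !sector_bot //; apply: (side_ray_le BY im); lra.
rewrite !sector_mid; try lra.
have h1 := side_X_le AX im; have h2 := side_X_le BY im.
have h3 : 0 <= (2 * k%:R - u) * ((Y i.+1)%:r - (Y i)%:r) by apply: mulr_ge0; lra.
have h4 : 0 <= u * ((X i.+1)%:r - (X i)%:r) by apply: mulr_ge0; lra.
rewrite /x /y; lra.
Qed.

Lemma sector_le i j u : (i <= j)%N -> (j <= m)%N -> - k%:R <= u -> u <= 3 * k%:R ->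
  sector i u <= sector j u.
Proof.
move=> + + uk ku; elim: j => [|j IH]; first by rewrite leqn0 => /eqP->.
rewrite leq_eqVlt => /orP[/eqP->//|ij] jm.
by apply: le_trans (sector_leS jm uk ku); apply: IH => //; apply: ltnW.
Qed.

Definition face_closed (i : nat) := poly_closed lab_pt (face_edge A B i).
Definition face_open (i : nat) := poly_open lab_pt (face_edge A B i).

Lemma face_closed_sides i z : (i < m)%N -> face_closed i z ->
  [/\ 0 <= chord_side i z, chord_side i.+1 z <= 0,
      forall a, (A i <= a)%N -> (a < A i.+1)%N ->
        0 <= edge_line A X k i a (chord_side i z) (above z) &
      forall b, (B i <= b)%N -> (b < B i.+1)%N ->
        0 <= edge_line B Y k i b (chord_side i z) (below z)].
Proof.
move=> im cz; have k0 := kR_gt0 im.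
have k2 : 0 < 2 * k%:R :> RR by rewrite mulr_gt0.
have := cz (true, A i) (false, B i); have := cz (false, B i.+1) (true, A i.+1).
rewrite /= !eqxx cross_left ?cross_right // 1?ltnW // => /(_ isT) + /(_ isT).
rewrite oppr_ge0 pmulr_rle0 // pmulr_rge0 // => R0 L0; split => //.
- move=> a ia ai; have := cz (true, a.+1) (true, a).
  by rewrite /= eqxx ia ai (cross_top _ im ia ai); apply.
- move=> b ib bi; have := cz (false, b) (false, b.+1).
  by rewrite /= eqxx ib bi (cross_bot _ im ib bi); apply.
Qed.

Lemma face_closed_mid i z : (i < m)%N -> 0 <= z.2 -> z.2 <= 2 * k%:R ->
  0 <= chord_side i z -> chord_side i.+1 z <= 0 -> face_closed i z.
Proof.
move=> im z0 zk L0 R0; have k0 := kR_gt0 im.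
have k2 : 0 < 2 * k%:R :> RR by rewrite mulr_gt0.
move=> [[] a] [[] b] /=.
- move=> /and3P[/eqP-> ib bi]; rewrite (cross_top _ im ib bi).
  apply: (edge_line_below AX im (Ak im)) => //; last by rewrite /above; lra.
  by move: R0; rewrite chord_side_diff !rmorphB /= /x /y; lra.
- move=> /andP[/eqP-> /eqP->]; rewrite cross_left 1?ltnW //.
  by rewrite pmulr_rge0.
- move=> /andP[/eqP-> /eqP->]; rewrite cross_right // oppr_ge0.
  by rewrite pmulr_rle0.
- move=> /and3P[/eqP-> ib bi]; rewrite (cross_bot _ im ib bi).
  apply: (edge_line_below BY im (Bk im)) => //; last by rewrite /below; lra.
  by move: R0; rewrite chord_side_diffb !rmorphB /= /x /y; lra.
Qed.

Lemma face_closed_top i z : (i < m)%N -> face_closed i z -> 2 * k%:R < z.2 ->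
  [/\ sector i z.2 < z.1, z.1 < sector i.+1 z.2 & z.2 < 3 * k%:R].
Proof.
move=> im cz zk; have [L0 R0 he _] := face_closed_sides im cz.
have h0 : 0 < above z by rewrite /above subr_gt0.
have [Ai Xe _] := AX.2 i im; have Yle := side_X_le BY im.
rewrite !sector_top 1?ltW //.
move: Ai; rewrite leq_eqVlt => /orP[/eqP e|AA].
  (* Without top edges the two chords meet at height [2 * k] and have swapped sides above it. *)
  exfalso; have BB : (B i < B i.+1)%N by have := AB im; lia.
  have [_ _ w'0 _ _] := side_face_real BY im BB.
  have hh := mulr_gt0 w'0 h0.
  move: R0; rewrite chord_side_diff /x /y -(Xe e).1 => R0; lra.
have [_ _ _ re _] := side_face_real AX im AA.
have w'0 : 0 <= (X i.+1)%:r - (X i)%:r + ((X i - Y i)%:r - (X i.+1 - Y i.+1)%:r).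
  by rewrite !rmorphB /=; lra.
have [] := side_zone AX im AA (Ak im) w'0 h0 he.
rewrite re !rmorphB /= /chord_side /above /x /y => g1 g2 g3.
by split; lra.
Qed.

Lemma face_closed_bot i z : (i < m)%N -> face_closed i z -> z.2 < 0 ->
  [/\ sector i z.2 < z.1, z.1 < sector i.+1 z.2 & - k%:R < z.2].
Proof.
move=> im cz zk; have [L0 R0 _ he] := face_closed_sides im cz.
have h0 : 0 < below z by rewrite /below oppr_gt0.
have [Bi Ye _] := BY.2 i im; have Xle := side_X_le AX im.
rewrite !sector_bot 1?ltW //.
move: Bi; rewrite leq_eqVlt => /orP[/eqP e|BB].
  exfalso; have AA : (A i < A i.+1)%N by have := AB im; lia.
  have [_ _ w'0 _ _] := side_face_real AX im AA.
  have hh := mulr_gt0 w'0 h0.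
  move: R0; rewrite chord_side_diffb /x /y -(Ye e).1 => R0; lra.
have [_ _ _ re _] := side_face_real BY im BB.
have w'0 : 0 <= (Y i.+1)%:r - (Y i)%:r + ((Y i - X i)%:r - (Y i.+1 - X i.+1)%:r).
  by rewrite !rmorphB /=; lra.
have [] := side_zone BY im BB (Bk im) w'0 h0 he.
rewrite re !rmorphB /= /chord_side /below /x /y => g1 g2 g3.
by split; lra.
Qed.

Lemma face_closed_range i z : (i < m)%N -> face_closed i z ->
  - k%:R < z.2 /\ z.2 < 3 * k%:R.
Proof.
move=> im cz; have k0 := kR_gt0 im.
have [h|h] := ltP (2 * k%:R) z.2.
  by have [_ _ ?] := face_closed_top im cz h; split; lra.
have [h'|h'] := ltP z.2 0; last by split; lra.
by have [_ _ ?] := face_closed_bot im cz h'; split; lra.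
Qed.

Lemma face_closed_sector i z : (i < m)%N -> face_closed i z ->
  sector i z.2 <= z.1 /\ z.1 <= sector i.+1 z.2.
Proof.
move=> im cz; have [h|h] := ltP (2 * k%:R) z.2.
  by have [? ? _] := face_closed_top im cz h; split; apply: ltW.
have [h'|h'] := ltP z.2 0.
  by have [? ? _] := face_closed_bot im cz h'; split; apply: ltW.
have [L0 R0 _ _] := face_closed_sides im cz; move: L0 R0.
by rewrite !sector_mid // /chord_side => L0 R0; split; lra.
Qed.

Lemma face_open_sector i z : (i < m)%N -> face_open i z ->
  sector i z.2 < z.1 /\ z.1 < sector i.+1 z.2.
Proof.
move=> im oz; have cz : face_closed i z by exact: poly_open_sub.
have [h|h] := ltP (2 * k%:R) z.2.
  by have [? ? _] := face_closed_top im cz h.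
have [h'|h'] := ltP z.2 0.
  by have [? ? _] := face_closed_bot im cz h'.
have k0 := kR_gt0 im.
have k2 : 0 < 2 * k%:R :> RR by rewrite mulr_gt0.
have := oz (true, A i) (false, B i); have := oz (false, B i.+1) (true, A i.+1).
rewrite /= !eqxx cross_left ?cross_right // 1?ltnW // => /(_ isT) + /(_ isT).
rewrite oppr_gt0 pmulr_rlt0 // pmulr_rgt0 // !sector_mid // /chord_side => L0 R0.
by split; lra.
Qed.

(** * Intersections of faces, chords and edges *)

Lemma sector_unique i j z : (i < m)%N -> (j < m)%N ->
  - k%:R < z.2 -> z.2 < 3 * k%:R ->
  sector i z.2 < z.1 -> z.1 < sector i.+1 z.2 ->
  sector j z.2 <= z.1 -> z.1 <= sector j.+1 z.2 -> i = j.
Proof.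
move=> im jm /ltW r1 /ltW r2 s1 s2 c1 c2; have [ij|ji|//] := ltngtP i j.
  have h := @sector_le i.+1 j z.2 ij (ltnW jm) r1 r2.
  by have := lt_le_trans s2 (le_trans h c1); rewrite ltxx.
have h := @sector_le j.+1 i z.2 ji (ltnW im) r1 r2.
by have := lt_le_trans s1 (le_trans c2 h); rewrite ltxx.
Qed.

Lemma face_open_closed i j z : (i < m)%N -> (j < m)%N -> face_open i z ->
  face_closed j z -> i = j.
Proof.
move=> im jm oz cz; have [s1 s2] := face_open_sector im oz.
have [c1 c2] := face_closed_sector jm cz.
have [r1 r2] := face_closed_range jm cz.
exact: (sector_unique im jm r1 r2).
Qed.

(** Above and below the two base lines a closed face is strictly inside its sector, so two faces can
    only touch between these lines, on their chords. *)
Lemma face_closed_meet i j z : (i < j)%N -> (j < m)%N -> face_closed i z ->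
  face_closed j z ->
  [/\ 0 <= z.2, z.2 <= 2 * k%:R, chord_side i.+1 z = 0 & chord_side j z = 0].
Proof.
move=> ij jm ci cj; have im := ltn_trans ij jm.
have [r1 r2] := face_closed_range jm cj.
have [s1 s2] := face_closed_sector im ci.
have [c1 c2] := face_closed_sector jm cj.
have h := @sector_le i.+1 j z.2 ij (ltnW jm) (ltW r1) (ltW r2).
have z1 : z.2 <= 2 * k%:R.
  rewrite leNgt; apply/negP => z1.
  by have [_ ? _] := face_closed_top im ci z1; lra.
have z0 : 0 <= z.2.
  rewrite leNgt; apply/negP => z0.
  by have [_ ? _] := face_closed_bot im ci z0; lra.
split => //; move: s2 c1 h; rewrite !sector_mid // /chord_side => s2 c1 h; lra.
Qed.

Lemma chord_segment i z : (i <= m)%N -> (0 < m)%N -> 0 <= z.2 -> z.2 <= 2 * k%:R ->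
  chord_side i z = 0 -> segment (lab_pt (true, A i)) (lab_pt (false, B i)) z.
Proof.
move=> im m0 z0 zk cz; have k0 := kR_gt0 m0.
have k2 : 0 < 2 * k%:R :> RR by rewrite mulr_gt0.
rewrite chord_top // chord_bot //; exists (1 - z.2 / (2 * k%:R)).
have h1 : z.2 / (2 * k%:R) <= 1 by rewrite ler_pdivrMr // mul1r.
have h0 : 0 <= z.2 / (2 * k%:R) by rewrite divr_ge0 // ltW.
split; [by lra| by lra|].
have e : z.2 / (2 * k%:R) * (2 * k%:R) = z.2 by rewrite divfK // gt_eqF.
rewrite [LHS]surjective_pairing; congr pair => /=.
  have -> : z.1 = 2 * k%:R * y i + (x i - y i) * z.2 by move: cz; rewrite /chord_side; lra.
  by rewrite -{1}e; ring.
by rewrite -{1}e; ring.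
Qed.

Lemma AB_mono i j : (i < j)%N -> (j <= m)%N -> (A i + B i < A j + B j)%N.
Proof.
elim: j => [//|j IH]; rewrite ltnS leq_eqVlt => /orP[/eqP->|ij] jm; first exact: AB.
exact: ltn_trans (IH ij (ltnW jm)) (AB jm).
Qed.

Lemma face_closed_vertex i l : (i < m)%N -> face_mem i l -> face_closed i (lab_pt l).
Proof.
by move=> im /(face_edge_next im)[l' ll']; apply: (poly_vertex_closed (face_ccw im) ll').
Qed.

Lemma face_inj i l v : (i < m)%N -> face_mem i l -> face_mem i v ->
  lab_pt l = lab_pt v -> l = v.
Proof.
move=> im /(face_edge_next im)[l' ll'] /(face_edge_next im)[v' vv'].
exact: (polygon_vertex_inj (face_ccw im) ll' vv').
Qed.

Definition chord_end (c : nat) (l : lab) := (l == (true, A c)) || (l == (false, B c)).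

Lemma chord_end_mem i c l : (i < m)%N -> (c == i) || (c == i.+1) -> chord_end c l ->
  face_mem i l.
Proof.
move=> im; have := A_le im; have := B_le im => Bi Ai.
by move=> /orP[]/eqP-> /orP[]/eqP->; rewrite /face_mem /= leqnn ?andbT.
Qed.

Lemma vertex_on_chord i c l : (i < m)%N -> (c == i) || (c == i.+1) -> face_mem i l ->
  chord_side c (lab_pt l) = 0 -> chord_end c l.
Proof.
move=> im ci; case: l => [[] a]; rewrite /face_mem /= => lm cz.
  have [_ _ _ L R] := top_vertex im lm; apply/orP; left.
  case/orP: ci cz => /eqP-> cz; apply/eqP; congr pair; apply/eqP; apply: contraT.
    by move=> /L; rewrite cz ltxx.
  by move=> /R; rewrite cz ltxx.
have [_ _ _ L R] := bot_vertex im lm; apply/orP; right.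
case/orP: ci cz => /eqP-> cz; apply/eqP; congr pair; apply/eqP; apply: contraT.
  by move=> /L; rewrite cz ltxx.
by move=> /R; rewrite cz ltxx.
Qed.

Lemma edge_on_chord i c l l' z : (i < m)%N -> (c == i) || (c == i.+1) ->
  face_edge A B i l l' -> segment (lab_pt l) (lab_pt l') z ->
  0 <= z.2 -> z.2 <= 2 * k%:R -> chord_side c z = 0 ->
  (forall v, chord_end c v -> (v == l) || (v == l')) \/
  exists v, [/\ (v == l) || (v == l'), chord_end c v & z = lab_pt v].
Proof.
move=> im ci ll' sz z0 zk cz.
have m0 : (0 < m)%N by apply: leq_ltn_trans im.
have cm : (c <= m)%N by case/orP: ci => /eqP-> //; exact: ltnW.
have sc := chord_segment cm m0 z0 zk cz.
have [p [q [Npq sq pq]]] : exists p q, [/\ face_edge A B i p q,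
    segment (lab_pt p) (lab_pt q) z &
    forall v, (v == p) || (v == q) = chord_end c v].
  case/orP: ci => /eqP ce; subst c.
    by exists (true, A i), (false, B i); rewrite /= !eqxx.
  exists (false, B i.+1), (true, A i.+1); split; rewrite /= ?eqxx //.
    exact: segmentC.
  by move=> v; rewrite /chord_end orbC.
have [e|ne] := eqVneq (l, l') (p, q).
  by left=> v; case: e => -> ->; rewrite pq.
have [v /andP[vl vp] zE] := poly_edges_meet (face_ccw im) ll' Npq ne sz sq.
by right; exists v; rewrite -pq.
Qed.

Lemma chords_meet c c' z : (c < c')%N -> (c' <= m)%N -> 0 <= z.2 -> z.2 <= 2 * k%:R ->
  chord_side c z = 0 -> chord_side c' z = 0 ->
  exists u, [/\ chord_end c u, chord_end c' u & z = lab_pt u].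
Proof.
move=> cc cm z0 zk e e'.
have c0m : (c <= m)%N by apply: ltnW; exact: leq_trans cc cm.
have [X1 X2] := side_X_mono AX (ltnW cc) cm.
have [Y1 Y2] := side_X_mono BY (ltnW cc) cm.
have A1 := side_mono AX (ltnW cc) cm; have B1 := side_mono BY (ltnW cc) cm.
have ab := AB_mono cc cm.
move: X1 Y1; rewrite -!(ler_int RR) -subr_ge0 -[X in _ -> is_true X -> _]subr_ge0 => X1 Y1.
have k0 : 0 <= 2 * k%:R - z.2 by rewrite subr_ge0.
have h1 := mulr_ge0 k0 Y1; have h2 := mulr_ge0 z0 X1.
(* A sum of two nonnegative terms: each vanishes, which puts [z] at the top or at the bottom end,
   and makes the two chords share that end. *)
have h3 : (2 * k%:R - z.2) * ((Y c')%:r - (Y c)%:r) + z.2 * ((X c')%:r - (X c)%:r) = 0.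
  by move: e e'; rewrite /chord_side /x /y => e e'; lra.
have [ex|nx] := eqVneq (X c) (X c').
  have AA : A c = A c'.
    apply/eqP; rewrite eqn_leq A1 leqNgt; apply/negP => /X2.
    by rewrite ex ltxx.
  have BB : (B c < B c')%N by rewrite -(ltn_add2l (A c)) {2}AA.
  have yy : (Y c)%:r < (Y c')%:r :> RR by rewrite ltr_int; exact: Y2.
  have zE : z.2 = 2 * k%:R.
    have : (2 * k%:R - z.2) * ((Y c')%:r - (Y c)%:r) = 0 by move: h3; rewrite ex subrr; lra.
    by move/eqP; rewrite mulf_eq0 => /orP[/eqP|/eqP]; lra.
  exists (true, A c); rewrite /chord_end -AA eqxx; split => //.
  rewrite chord_top // [LHS]surjective_pairing zE; congr pair.
  by move: e; rewrite /chord_side zE; lra.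
have xx : 0 < (X c')%:r - (X c)%:r :> RR by rewrite subr_gt0 lt_neqAle eqr_int nx -subr_ge0.
have zE : z.2 = 0.
  have : z.2 * ((X c')%:r - (X c)%:r) = 0 by lra.
  by move/eqP; rewrite mulf_eq0 => /orP[/eqP|/eqP]; lra.
have yy : (Y c)%:r = (Y c')%:r :> RR.
  have k1 : 0 < 2 * k%:R :> RR.
    by rewrite mulr_gt0 // (@kR_gt0 c) //; exact: leq_trans cc cm.
  have : 2 * k%:R * ((Y c')%:r - (Y c)%:r) = 0 by move: h3; rewrite zE; lra.
  by move/eqP; rewrite mulf_eq0 => /orP[/eqP|/eqP]; lra.
have BB : B c = B c'.
  apply/eqP; rewrite eqn_leq B1 leqNgt; apply/negP => /Y2.
  by move/eqP: yy; rewrite eqr_int => /eqP->; rewrite ltxx.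
exists (false, B c); rewrite /chord_end -BB eqxx !orbT; split => //.
rewrite chord_bot // [LHS]surjective_pairing zE; congr pair.
by move: e; rewrite /chord_side zE; lra.
Qed.

Lemma lab_pt_inj i j l v : (i < m)%N -> (j < m)%N -> face_mem i l -> face_mem j v ->
  lab_pt l = lab_pt v -> l = v.
Proof.
wlog ij : i j l v / (i <= j)%N.
  move=> H im jm il jv e; have [ij|ji] := leqP i j; first exact: (H i j).
  by apply/esym; apply: (H j i) => //; apply: ltnW.
move=> im jm il jv e; move: ij; rewrite leq_eqVlt => /orP[/eqP ij|ij].
  by apply: (face_inj jm) => //; rewrite -ij.
have cl := face_closed_vertex im il; have cv := face_closed_vertex jm jv.
rewrite e in cl; have [z0 zk e1 e2] := face_closed_meet ij jm cl cv.
have lc : chord_end i.+1 l by apply: (vertex_on_chord im); rewrite ?eqxx ?orbT // e.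
have vc : chord_end j v by apply: (vertex_on_chord jm); rewrite ?eqxx.
move: ij; rewrite leq_eqVlt => /orP[/eqP ij|ij].
  by apply: (face_inj jm) => //; apply: (chord_end_mem jm (c := j)); rewrite ?eqxx // -ij.
have [u [u1 u2 zE]] := chords_meet ij (ltnW jm) z0 zk e1 e2.
have -> : l = u.
  apply: (face_inj im) => //; last by rewrite e.
  by apply: (chord_end_mem im _ u1); rewrite eqxx orbT.
apply: (face_inj jm) => //.
by apply: (chord_end_mem jm _ u2); rewrite eqxx.
Qed.

Lemma face_edges_meet i j l l' v w z : (i < m)%N -> (j < m)%N ->
  face_edge A B i l l' -> face_edge A B j v w ->
  ~~ ((l == v) && (l' == w) || (l == w) && (l' == v)) ->
  segment (lab_pt l) (lab_pt l') z -> segment (lab_pt v) (lab_pt w) z ->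
  exists2 u, ((u == l) || (u == l')) && ((u == v) || (u == w)) & z = lab_pt u.
Proof.
wlog ij : i j l l' v w / (i <= j)%N.
  move=> H im jm Nl Nv ne sl sv; have [ij|ji] := leqP i j; first exact: (H i j).
  have [] := H j i v w l l' (ltnW ji) jm im Nv Nl _ sv sl.
    apply: contra ne; rewrite ![v == _]eq_sym ![w == _]eq_sym.
    by rewrite [(_ == w) && _]andbC.
  by move=> u hu zE; exists u => //; rewrite andbC.
move=> im jm Nl Nv ne sl sv; move: ij; rewrite leq_eqVlt => /orP[/eqP ij|ij].
  subst j; apply: (poly_edges_meet (face_ccw im) Nl Nv) => //.
  by apply: contra ne => /eqP[-> ->]; rewrite !eqxx.
have cl : face_closed i z := poly_edge_closed (face_ccw im) Nl sl.
have cv : face_closed j z := poly_edge_closed (face_ccw jm) Nv sv.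
have [z0 zk e1 e2] := face_closed_meet ij jm cl cv.
have H1 := edge_on_chord im (_ : (i.+1 == i) || (i.+1 == i.+1)) Nl sl z0 zk e1.
have H2 := edge_on_chord jm (_ : (j == j) || (j == j.+1)) Nv sv z0 zk e2.
rewrite eqxx orbT in H1; rewrite eqxx in H2.
have {}H1 := H1 isT; have {}H2 := H2 isT.
have M1 u : chord_end i.+1 u -> face_mem i u.
  by apply: chord_end_mem => //; rewrite eqxx orbT.
have M2 u : chord_end j u -> face_mem j u.
  by apply: chord_end_mem => //; rewrite eqxx.
move: ij; rewrite leq_eqVlt => /orP[/eqP ij|ij]; last first.
  have [u [u1 u2 zE]] := chords_meet ij (ltnW jm) z0 zk e1 e2.
  exists u => //; apply/andP; split.
    case: H1 => [/(_ u u1)//|[v1 [v1l v1c zv]]].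
    by rewrite (_ : u = v1) //; apply: (face_inj im); rewrite ?M1 -?zE.
  case: H2 => [/(_ u u2)//|[v1 [v1l v1c zv]]].
  by rewrite (_ : u = v1) //; apply: (face_inj jm); rewrite ?M2 -?zE.
rewrite -ij in H2 M2 e2.
case: H1 => [H1|[v1 [v1l v1c zv1]]]; case: H2 => [H2|[v2 [v2l v2c zv2]]].
(* Both edges join the two ends of the common chord, so they are the same edge. *)
- exfalso; have a1 := H1 (true, A i.+1); have a2 := H1 (false, B i.+1).
  have b1 := H2 (true, A i.+1); have b2 := H2 (false, B i.+1).
  move: a1 a2 b1 b2; rewrite /chord_end !eqxx orbT.
  move=> /(_ isT) a1 /(_ isT) a2 /(_ isT) b1 /(_ isT) b2.
  case/orP: a1 => /eqP a1; case/orP: a2 => /eqP a2;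
    case/orP: b1 => /eqP b1; case/orP: b2 => /eqP b2; move: ne;
    try (by move: a2; rewrite -a1); try (by move: b2; rewrite -b1);
    by rewrite -a1 -a2 -b1 -b2 !eqxx ?orbT.
- by exists v2 => //; rewrite v2l andbT; apply: H1.
- by exists v1 => //; rewrite v1l; apply: H2.
- exists v1 => //; rewrite v1l /= (_ : v1 = v2) //.
  by apply: (face_inj im); rewrite ?M1 // -zv1.
Qed.

(** * The faces are components of the complement *)

Definition drawn : set plane := [set z | exists i l l',
  [/\ (i < m)%N, face_edge A B i l l' & segment (lab_pt l) (lab_pt l') z]].

Lemma drawn_face_closed z : drawn z -> exists2 i, (i < m)%N & face_closed i z.
Proof.
move=> [i [l [l' [im ll' sz]]]]; exists i => //.
exact: (poly_edge_closed (face_ccw im) ll').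
Qed.

Lemma face_closed_open i z : (i < m)%N -> face_closed i z -> ~ face_open i z -> drawn z.
Proof.
move=> im cz noz; apply: contrapT => nd; apply: noz => l l' ll'.
rewrite lt_neqAle (cz _ _ ll') andbT eq_sym; apply/eqP => c0; apply: nd.
by exists i, l, l'; split => //; apply: (poly_tight (face_ccw im)).
Qed.

Lemma face_open_drawn i z : (i < m)%N -> face_open i z -> ~ drawn z.
Proof.
move=> im oz [j [l [l' [jm ll' sz]]]].
have cz : face_closed j z := poly_edge_closed (face_ccw jm) ll' sz.
have ij := face_open_closed im jm oz cz; subst j.
have := oz _ _ ll'; have [t [_ _ _ ->]] := cross_segment (lab_pt l) (lab_pt l') sz.
by rewrite (_ : _ + _ = 0) ?ltxx // /cross; ring.
Qed.

Lemma face_component i z : (i < m)%N -> face_open i z ->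
  connected_component (~` drawn) z = face_open i.
Proof.
move=> im oz; apply: (@component_open_face _ _ (face_closed i)) => //.
- pose ls := [seq (b, j) | b <- [:: true; false], j <- iota 0 (A i.+1 + B i.+1).+1].
  apply: (@open_poly_open _ _ _ [seq (l, l') | l <- ls, l' <- ls]) => l l' ll'.
  have lsP v : face_mem i v -> v \in ls.
    case: v => b j h; apply: allpairs_f; first by case: b {h}.
    by rewrite mem_iota; move: h; rewrite /face_mem; case: b => /=; lia.
  by have [h h'] := face_edge_mem im ll'; apply: allpairs_f; apply: lsP.
- exact: closed_poly_closed.
- exact: poly_open_sub.
- by move=> w [cw now]; apply: face_closed_open now.
- by apply/seteqP; split => // w [ow]; apply: face_open_drawn ow.
- exact: convex_poly_open.
Qed.

Lemma chord_end_pt c z : (c <= m)%N -> (0 < m)%N -> chord_side c z = 0 ->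
  (z.2 = 2 * k%:R -> z = lab_pt (true, A c)) /\ (z.2 = 0 -> z = lab_pt (false, B c)).
Proof.
move=> cm m0; rewrite chord_top // chord_bot // /chord_side.
by case: z => z1 z2 /= cz; split => e; congr pair => //; rewrite e in cz; lra.
Qed.

(** Corners are required at every vertex in the closure of a face, including those that come from
    another face; such a vertex is also an end of a chord of face [i]. *)
Lemma vertex_in_face i j l : (i < m)%N -> (j < m)%N -> face_mem j l ->
  face_closed i (lab_pt l) -> exists2 v, face_mem i v & lab_pt l = lab_pt v.
Proof.
move=> im jm jl cl; have m0 : (0 < m)%N by apply: leq_ltn_trans im.
have cj := face_closed_vertex jm jl.
have [ij|ij|ij] := ltngtP i j; last by exists l => //; rewrite ij.
- have [z0 zk e1 e2] := face_closed_meet ij jm cl cj.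
  have [p1 p2] := chord_end_pt im m0 e1.
  have : chord_end j l by apply: (vertex_on_chord jm); rewrite ?eqxx.
  move=> /orP[]/eqP le.
    exists (true, A i.+1); first by rewrite /face_mem /= leqnn A_le.
    by apply: p1; rewrite le chord_top // ltnW.
  exists (false, B i.+1); first by rewrite /face_mem /= leqnn B_le.
  by apply: p2; rewrite le chord_bot // ltnW.
- have [z0 zk e1 e2] := face_closed_meet ij im cj cl.
  have [p1 p2] := chord_end_pt (ltnW im) m0 e2.
  have : chord_end j.+1 l by apply: (vertex_on_chord jm); rewrite ?eqxx ?orbT.
  move=> /orP[]/eqP le.
    exists (true, A i); first by rewrite /face_mem /= leqnn A_le.
    by apply: p1; rewrite le chord_top.
  exists (false, B i); first by rewrite /face_mem /= leqnn B_le.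
  by apply: p2; rewrite le chord_bot.
Qed.

(** * Points outside the faces escape to infinity *)

Lemma drawn_range z : drawn z ->
  [/\ - k%:R < z.2, z.2 < 3 * k%:R, sector 0 z.2 <= z.1 & z.1 <= sector m z.2].
Proof.
move=> /drawn_face_closed[i im cz]; have [r1 r2] := face_closed_range im cz.
have [s1 s2] := face_closed_sector im cz; split => //.
  by apply: le_trans s1; apply: (sector_le (leq0n i) (ltnW im)); apply: ltW.
by apply: le_trans s2 _; apply: (sector_le im (leqnn m)); apply: ltW.
Qed.

(** Otherwise [z] would lie on a segment between two points of [C]. *)
Lemma segment_beyond (C : set plane) (b z : plane) (t : RR) :
  convex_pt C -> C b -> ~ C z -> 1 <= t ->
  ~ C (b.1 + t * (z.1 - b.1), b.2 + t * (z.2 - b.2)).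
Proof.
move=> cC Cb nz t1 Cp; apply: nz; apply: (cC _ _ Cb Cp).
have t0 : t != 0 by apply: lt0r_neq0; lra.
exists t^-1; split; first by rewrite invr_ge0; lra.
- by rewrite invf_le1; lra.
- by rewrite /= ![_ + t * _ - _]addrAC !subrr !add0r !mulKf // !subrKC; case: (z).
Qed.

Definition unbounded_from (z : plane) := forall M : RR, exists w,
  connected_component (~` drawn) z w /\ ((M < `|w.1|) || (M < `|w.2|)).

Lemma unbounded_above z : 3 * k%:R <= z.2 -> unbounded_from z.
Proof.
move=> zk M; exists (z.1, z.2 + `|M| + 1); split; last first.
  have k0 : 0 <= k%:R :> RR by [].
  apply/orP; right; rewrite /= ger0_norm.
    by have := ler_norm M; lra.
  by have := normr_ge0 M; lra.
apply: segment_component => p [t [t0 t1 ->]] /drawn_range[_ /= + _ _].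
have := mulr_ge0 t0 (_ : 0 <= z.2 + `|M| + 1 - z.2).
by have := normr_ge0 M; move=> + /(_ ltac:(lra)); lra.
Qed.

Lemma unbounded_below z : z.2 <= - k%:R -> unbounded_from z.
Proof.
move=> zk M; exists (z.1, z.2 - (`|M| + 1)); split; last first.
  have k0 : 0 <= k%:R :> RR by [].
  apply/orP; right; rewrite /= ler0_norm.
    by have := ler_norm M; lra.
  by have := normr_ge0 M; lra.
apply: segment_component => p [t [t0 t1 ->]] /drawn_range[/= + _ _ _].
have := mulr_ge0 t0 (_ : 0 <= - (z.2 - (`|M| + 1) - z.2)).
by have := normr_ge0 M; move=> + /(_ ltac:(lra)); lra.
Qed.

Lemma unbounded_left z : z.1 < sector 0 z.2 -> unbounded_from z.
Proof.
move=> zs M; exists (z.1 - (`|M| + `|z.1| + 1), z.2); split; last first.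
  apply/orP; left; rewrite /= ler0_norm.
    by have := ler_norm M; have := ler_norm z.1; lra.
  by have := normr_ge0 M; have := ler_norm z.1; lra.
apply: segment_component => p [t [t0 t1 ->]] /drawn_range[/= _ _].
rewrite subrr mulr0 addr0 => h _; move: h.
have := mulr_ge0 t0 (_ : 0 <= - (z.1 - (`|M| + `|z.1| + 1) - z.1)).
by have := normr_ge0 M; have := normr_ge0 z.1; move=> + + /(_ ltac:(lra)); lra.
Qed.

Lemma unbounded_right z : sector m z.2 < z.1 -> unbounded_from z.
Proof.
move=> zs M; exists (z.1 + (`|M| + `|z.1| + 1), z.2); split; last first.
  apply/orP; left; rewrite /= ger0_norm.
    by have := ler_norm M; have := ler_norm (- z.1); rewrite normrN; lra.
  by have := normr_ge0 M; have := ler_norm (- z.1); rewrite normrN; lra.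
apply: segment_component => p [t [t0 t1 ->]] /drawn_range[/= _ _ _].
rewrite subrr mulr0 addr0.
have := mulr_ge0 t0 (_ : 0 <= z.1 + (`|M| + `|z.1| + 1) - z.1).
by have := normr_ge0 M; have := normr_ge0 z.1; move=> + + /(_ ltac:(lra)); lra.
Qed.

Lemma unbounded_trans z w : segment z w `<=` ~` drawn -> unbounded_from w ->
  unbounded_from z.
Proof.
move=> /segment_component zw uw M; have [v [wv hv]] := uw M.
by exists v; split => //; apply: connected_component_trans wv.
Qed.

(** Interpolating base points and slopes with the same weight [s] gives a line that stays between
    the two rays as long as these do not cross. *)
Lemma ray_between (S0 S1 r0 r1 h u : RR) :
  S0 + r0 * h <= u -> u <= S1 + r1 * h -> S0 <= S1 ->
  exists b r, [/\ S0 <= b, b <= S1, u = b + r * h &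
    forall h', S0 + r0 * h' <= S1 + r1 * h' ->
      S0 + r0 * h' <= b + r * h' <= S1 + r1 * h'].
Proof.
move=> u0 u1 S01.
have [s [s0 s1 uE]] : exists s, [/\ 0 <= s, s <= 1 &
    u = S0 + r0 * h + s * (S1 + r1 * h - (S0 + r0 * h))].
  have [e|ne] := eqVneq (S0 + r0 * h) (S1 + r1 * h).
    by exists 0; split => //; lra.
  have d0 : 0 < S1 + r1 * h - (S0 + r0 * h).
    by rewrite subr_gt0 lt_neqAle ne (le_trans u0).
  exists ((u - (S0 + r0 * h)) / (S1 + r1 * h - (S0 + r0 * h))); split.
  - by rewrite divr_ge0 ?subr_ge0 // ltW // -subr_gt0.
  - by rewrite ler_pdivrMr // mul1r lerD2r.
  - by rewrite divfK ?gt_eqF // subrKC.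
have comb (a b : RR) : a <= b -> a <= a + s * (b - a) <= b.
  move=> ab; have h1 : 0 <= s * (b - a) by rewrite mulr_ge0 ?subr_ge0.
  have h2 : 0 <= (1 - s) * (b - a) by rewrite mulr_ge0 ?subr_ge0.
  by apply/andP; split; lra.
have /andP[b0 b1] := comb _ _ S01.
exists (S0 + s * (S1 - S0)), (r0 + s * (r1 - r0)); split => //.
  by rewrite uE; ring.
move=> h' /comb; set u' := (X in _ <= X <= _ -> _).
by have -> : u' = S0 + s * (S1 - S0) + (r0 + s * (r1 - r0)) * h' by rewrite /u'; ring.
Qed.

(* Inside a sector we escape along the line through [z] that meets the base of
   the sector in a point [(b, c)] of the face: past [z], convexity of the face
   keeps this line out of it. *)
Lemma sector_escape i (b c r sg h : RR) : (i < m)%N ->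
  face_closed i (b, c) -> ~ face_closed i (b + r * h, c + sg * h) ->
  0 < h -> h <= k%:R ->
  (forall j h', (j < m)%N -> h <= h' -> h' <= k%:R ->
     face_closed j (b + r * h', c + sg * h') -> j = i) ->
  unbounded_from (b + r * k%:R, c + sg * k%:R) ->
  unbounded_from (b + r * h, c + sg * h).
Proof.
move=> im cb nz h0 hk own; apply: unbounded_trans => p [t [t0 t1 pE]].
move=> /drawn_face_closed[j jm cj].
have [h' [hh' h'k {}pE]] : exists h', [/\ h <= h', h' <= k%:R &
    p = (b + r * h', c + sg * h')].
  have kh : 0 <= k%:R - h by rewrite subr_ge0.
  exists (h + t * (k%:R - h)); split; last by rewrite pE /=; congr pair; ring.
    by rewrite lerDl mulr_ge0.
  by have := mulr_ge0 (_ : 0 <= 1 - t) kh; rewrite subr_ge0 => /(_ t1); lra.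
subst p; have ji := own _ _ jm hh' h'k cj; subst j.
have t'1 : 1 <= h' / h by rewrite ler_pdivlMr // mul1r.
apply: (segment_beyond (@convex_poly_closed _ _ _) cb nz t'1).
have e1 : b + h' / h * (b + r * h - b) = b + r * h'.
  by rewrite addrAC subrr add0r mulrCA divfK // lt0r_neq0.
have e2 : c + h' / h * (c + sg * h - c) = c + sg * h'.
  by rewrite addrAC subrr add0r mulrCA divfK // lt0r_neq0.
by rewrite /= e1 e2.
Qed.

Lemma unbounded_sector_top i z : (i < m)%N -> ~ face_closed i z ->
  2 * k%:R < z.2 -> z.2 < 3 * k%:R ->
  sector i z.2 <= z.1 -> z.1 <= sector i.+1 z.2 -> unbounded_from z.
Proof.
move=> im ncz zk kz; have k0 := kR_gt0 im.
have k2 : 0 <= 2 * k%:R :> RR by rewrite mulr_ge0.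
rewrite !sector_top ?(ltW zk) // => s1 s2.
have [h [h0 hk zh]] : exists h, [/\ 0 < h, h < k%:R & z.2 = 2 * k%:R + 1 * h].
  by exists (z.2 - 2 * k%:R); split; lra.
have zh' : z.2 - 2 * k%:R = h by rewrite zh mul1r addrAC subrr add0r.
rewrite zh' in s1 s2.
have xx : 2 * k%:R * x i <= 2 * k%:R * x i.+1 by apply: ler_wpM2l => //; apply: (side_X_le AX im).
have [b [r [b0 b1 zE between]]] := ray_between s1 s2 xx.
have {}zE : z = (b + r * h, 2 * k%:R + 1 * h).
  by rewrite [LHS]surjective_pairing zE zh.
subst z; apply: (sector_escape im _ ncz h0 (ltW hk)).
- apply: face_closed_mid => //=.
    have -> : chord_side i (b, 2 * k%:R) = b - 2 * k%:R * x i.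
      by rewrite /chord_side /=; ring.
    by rewrite subr_ge0.
  have -> : chord_side i.+1 (b, 2 * k%:R) = b - 2 * k%:R * x i.+1.
    by rewrite /chord_side /=; ring.
  by rewrite subr_le0.
(* The escape line stays in the closed sector of face [i], while points of face [j] above the line
   are strictly inside their sector; hence [j = i]. *)
- move=> j h' jm hh' h'k cj; have h'0 := lt_le_trans h0 hh'.
  have p2 : 2 * k%:R < (b + r * h', 2 * k%:R + 1 * h').2 by rewrite /= mul1r ltrDl.
  have [j1 j2 j3] := face_closed_top jm cj p2.
  have p3 : - k%:R < (b + r * h', 2 * k%:R + 1 * h').2.
    by apply: le_lt_trans p2; apply: le_trans k2; rewrite oppr_le0.
  have /andP[i1 i2] := between h' (side_ray_le AX im (ltW h'0) h'k).
  by apply: (sector_unique jm im p3 j3 j1 j2);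
    rewrite sector_top ?(ltW p2) //= mul1r [_ + h' - _]addrAC subrr add0r.
- by apply: unbounded_above; rewrite /=; lra.
Qed.

Lemma unbounded_sector_bot i z : (i < m)%N -> ~ face_closed i z ->
  z.2 < 0 -> - k%:R < z.2 ->
  sector i z.2 <= z.1 -> z.1 <= sector i.+1 z.2 -> unbounded_from z.
Proof.
move=> im ncz zk kz; have k0 := kR_gt0 im.
have k2 : 0 <= 2 * k%:R :> RR by rewrite mulr_ge0.
rewrite !sector_bot ?(ltW zk) // => s1 s2.
have [h [h0 hk zh]] : exists h, [/\ 0 < h, h < k%:R & z.2 = 0 + -1 * h].
  by exists (- z.2); split; lra.
have zh' : - z.2 = h by rewrite zh add0r mulN1r opprK.
rewrite zh' in s1 s2.
have yy : 2 * k%:R * y i <= 2 * k%:R * y i.+1 by apply: ler_wpM2l => //; apply: (side_X_le BY im).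
have [b [r [b0 b1 zE between]]] := ray_between s1 s2 yy.
have {}zE : z = (b + r * h, 0 + -1 * h).
  by rewrite [LHS]surjective_pairing zE zh.
subst z; apply: (sector_escape im _ ncz h0 (ltW hk)).
- apply: face_closed_mid => //=.
    have -> : chord_side i (b, 0) = b - 2 * k%:R * y i.
      by rewrite /chord_side /=; ring.
    by rewrite subr_ge0.
  have -> : chord_side i.+1 (b, 0) = b - 2 * k%:R * y i.+1.
    by rewrite /chord_side /=; ring.
  by rewrite subr_le0.
- move=> j h' jm hh' h'k cj; have h'0 := lt_le_trans h0 hh'.
  have p2 : (b + r * h', 0 + -1 * h').2 < 0 by rewrite /= add0r mulN1r oppr_lt0.
  have [j1 j2 j3] := face_closed_bot jm cj p2.
  have p3 : (b + r * h', 0 + -1 * h').2 < 3 * k%:R.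
    by apply: lt_le_trans p2 _; rewrite mulr_ge0.
  have /andP[i1 i2] := between h' (side_ray_le BY im (ltW h'0) h'k).
  by apply: (sector_unique jm im j3 p3 j1 j2);
    rewrite sector_bot ?(ltW p2) //= add0r mulN1r opprK.
- by apply: unbounded_below; rewrite /=; lra.
Qed.

Lemma sector_find j z : sector 0 z.2 <= z.1 -> z.1 <= sector j z.2 -> (0 < j)%N ->
  exists2 i, (i < j)%N & sector i z.2 <= z.1 /\ z.1 <= sector i.+1 z.2.
Proof.
move=> s0; elim: j => [//|j IH] sj _.
have [lt|le] := leP (sector j z.2) z.1; first by exists j.
case: j IH sj le => [|j] IH sj le; first by move: le; rewrite ltNge s0.
by have [] := IH (ltW le) isT => i ij hi; exists i => //; apply: ltnW.
Qed.

Lemma outer_unbounded z : (0 < m)%N -> (forall i, (i < m)%N -> ~ face_closed i z) ->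
  unbounded_from z.
Proof.
move=> m0 nz; have [h|h3] := leP (3 * k%:R) z.2; first exact: unbounded_above.
have [h|h1] := leP z.2 (- k%:R); first exact: unbounded_below.
have [s0|s0] := ltP z.1 (sector 0 z.2); first exact: unbounded_left.
have [sm|sm] := ltP (sector m z.2) z.1; first exact: unbounded_right.
have [i im [si si1]] := sector_find s0 sm m0.
have [h|h2] := ltP (2 * k%:R) z.2.
  exact: (unbounded_sector_top im (nz i im)).
have [h|h0] := ltP z.2 0; first exact: (unbounded_sector_bot im (nz i im)).
exfalso; apply: (nz i im); move: si si1; rewrite !sector_mid // => si si1.
by apply: face_closed_mid => //; rewrite /chord_side; lra.
Qed.

Lemma drawn_bounded_component z : (0 < m)%N -> ~ drawn z ->
  let F := connected_component (~` drawn) z in bounded_pt F ->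
  convex_pt F /\ forall j l, (j < m)%N -> face_mem j l -> closure F (lab_pt l) ->
    extreme_pt (closure F) (lab_pt l).
Proof.
move=> m0 nd F [M bM].
have [[i im oz]|no] := pselect (exists2 i, (i < m)%N & face_open i z).
  rewrite /F (face_component im oz); split; first exact: convex_poly_open.
  have sub : closure (face_open i) `<=` face_closed i.
    rewrite [X in _ `<=` X](closure_id _).1; last exact: closed_poly_closed.
    by apply: closure_subset; exact: poly_open_sub.
  move=> j l jm jl /sub cl.
  have [v iv ->] := vertex_in_face im jm jl cl.
  have [v' vv'] := face_edge_next im iv.
  move=> a b /sub ca /sub cb.
  exact: (poly_vertex_extreme (face_ccw im) vv' ca cb).
have [w [Fw]] : exists w, F w /\ ((M < `|w.1|) || (M < `|w.2|)).
  apply: outer_unbounded => // i im cz; apply: no; exists i => //.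
  by apply: contrapT => noz; apply: nd; apply: face_closed_open noz.
by have [w1 w2] := bM w Fw; rewrite !ltNge w1 w2.
Qed.

End Drawing.

(** * Outerplane embeddings by positions *)

Section Positions.
Variables (n : nat) (e : rel 'I_n).

Definition pos_set (pos : {perm 'I_n}) (P : nat -> Prop) : {set 'I_n} :=
  [set u : 'I_n | `[< P (pos u) >]].

Definition pos_rel (pos : {perm 'I_n}) (i j : nat) : Prop :=
  exists u v : 'I_n, [/\ val (pos u) = i, val (pos v) = j & e u v].

Lemma pos_relE (pos : {perm 'I_n}) u v : pos_rel pos (pos u) (pos v) <-> e u v.
Proof.
split=> [[u' [v' [/val_inj/perm_inj-> /val_inj/perm_inj->]]]//|euv].
by exists u, v.
Qed.

Lemma pos_surj (pos : {perm 'I_n}) i : (i < n)%N -> exists u, val (pos u) = i.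
Proof. by move=> lt; exists ((pos^-1)%g (Ordinal lt)); rewrite permKV. Qed.

Lemma in_pos_set (pos : {perm 'I_n}) P u : (u \in pos_set pos P) <-> P (pos u).
Proof. by rewrite inE; split=> /asboolP. Qed.

Lemma card_pos_set (pos : {perm 'I_n}) (P : nat -> Prop) (s : seq nat) : uniq s ->
  (forall i, i \in s -> (i < n)%N /\ P i) -> (size s <= #|pos_set pos P|)%N.
Proof.
move=> us sP; rewrite cardE.
pose t := [seq u <- enum 'I_n | val (pos u) \in s].
have st : {subset s <= [seq val (pos u) | u <- t]}.
  move=> i iS; have [u ui] := pos_surj pos (sP i iS).1.
  by apply/mapP; exists u => //; rewrite mem_filter ui iS mem_enum.
apply: leq_trans (uniq_leq_size us st) _; rewrite size_map.
apply: uniq_leq_size; first by rewrite filter_uniq // enum_uniq.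
move=> u; rewrite mem_filter mem_enum => /andP[us' _].
by apply/in_pos_set; exact: (sP _ us').2.
Qed.

Lemma consecutive_inC (pos : {perm 'I_n}) (S : {set 'I_n}) u v :
  consecutive_in pos S u v = consecutive_in pos S v u.
Proof. by rewrite /consecutive_in minnC maxnC. Qed.

Lemma consecutive_in_lt (pos : {perm 'I_n}) (P : nat -> Prop) (u v : 'I_n) : (pos u < pos v)%N ->
  consecutive_in pos (pos_set pos P) u v <->
  (forall z, (z < n)%N -> P z -> (pos u < z)%N -> (z < pos v)%N -> False) \/
  (forall z, (z < n)%N -> P z -> (pos u <= z)%N /\ (z <= pos v)%N).
Proof.
move=> uv; rewrite /consecutive_in (minn_idPl (ltnW uv)) (maxn_idPr (ltnW uv)).
split.
  move=> /orP[] /forallP H; [left|right] => z zn Pz.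
    have [w wz] := pos_surj pos zn; have := H w.
    have -> : w \in pos_set pos P by apply/in_pos_set; rewrite wz.
    by rewrite /= wz => /negP h1 h2 h3; apply: h1; rewrite h2 h3.
  have [w wz] := pos_surj pos zn; have := H w.
  have -> : w \in pos_set pos P by apply/in_pos_set; rewrite wz.
  by rewrite /= wz => /andP[].
move=> [] H; apply/orP; [left|right]; apply/forallP => w; apply/implyP => /in_pos_set Pw.
  by apply/negP => /andP[]; exact: (H _ (ltn_ord _)).
by apply/andP; exact: (H _ (ltn_ord _)).
Qed.

Lemma internal_face_pos (pos : {perm 'I_n}) (P : nat -> Prop) :
  (forall u v, e u v = e v u) -> (3 <= #|pos_set pos P|)%N ->
  (forall i j, (i < j)%N -> (j < n)%N -> P i -> P j ->
    (pos_rel pos i j <->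
     (forall z, (z < n)%N -> P z -> (i < z)%N -> (z < j)%N -> False) \/
     (forall z, (z < n)%N -> P z -> (i <= z)%N /\ (z <= j)%N))) ->
  internal_face e pos (pos_set pos P).
Proof.
move=> esym S3 H; split => // u v /in_pos_set Pu /in_pos_set Pv uv.
wlog lt : u v Pu Pv uv / (pos u < pos v)%N.
  move=> W; have [lt|lt|e'] := ltngtP (pos u) (pos v).
  - exact: W.
  - by rewrite consecutive_inC esym; apply: W => //; rewrite eq_sym.
  - by move/val_inj/perm_inj: e' uv => ->; rewrite eqxx.
apply: (iff_trans (iff_sym (pos_relE pos u v))).
apply: (iff_trans (H _ _ lt (ltn_ord _) Pu Pv)).
exact: iff_sym (consecutive_in_lt P lt).
Qed.

Section Rotation.
Variables (pos pos' : {perm 'I_n}) (r : nat).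
Hypothesis rn : (r <= n)%N.
Hypothesis posE : forall u,
  pos' u = (if pos u + r < n then pos u + r else pos u + r - n)%N :> nat.

Lemma rotation_consecutive (S : {set 'I_n}) u v :
  consecutive_in pos' S u v = consecutive_in pos S u v.
Proof.
wlog lt : u v / (pos u <= pos v)%N.
  move=> W; have [le|/ltnW le] := leqP (pos u) (pos v); first exact: W.
  by rewrite consecutive_inC W // consecutive_inC.
rewrite /consecutive_in (minn_idPl lt) (maxn_idPr lt).
have bd (w : 'I_n) : (pos w < n)%N by [].
have [e'|ne] := eqVneq u v.
  rewrite e' minnn maxnn; congr orb; last first.
    apply: eq_forallb => z; congr (_ ==> _).
    by have := posE v; have := posE z; have := bd v; have := bd z; case: ifP; case: ifP; lia.
  by apply: eq_forallb => z; congr (_ ==> _); lia.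
have {}lt : (pos u < pos v)%N.
  by rewrite ltn_neqAle lt andbT; apply: contra ne => /eqP/val_inj/perm_inj->.
have Eu := posE u; have Ev := posE v; have bu := bd u; have bv := bd v.
move: Eu; case: ltnP => hu Eu; move: Ev; case: ltnP => hv Ev.
- congr orb; apply: eq_forallb => z; congr (_ ==> _);
    have := posE z; have := bd z; rewrite Eu Ev; case: ifP; lia.
(* Only [v] wraps around, so the inner and the outer arc are exchanged, and with them the two
   disjuncts. *)
- rewrite orbC; congr orb; apply: eq_forallb => z; congr (_ ==> _);
    have := posE z; have := bd z; rewrite Eu Ev; case: ifP; lia.
- lia.
- congr orb; apply: eq_forallb => z; congr (_ ==> _);
    have := posE z; have := bd z; rewrite Eu Ev; case: ifP; lia.
Qed.

Lemma rotation_internal_face S : internal_face e pos' S -> internal_face e pos S.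
Proof.
by move=> [S3 H]; split => // u v uS vS uv; rewrite H // rotation_consecutive.
Qed.

Lemma rotation_embedding : (0 < n)%N -> (forall u v, e u v = e v u) ->
  outerplane_embedding e pos -> outerplane_embedding e pos'.
Proof.
move=> n0 esym [cyc nc]; have bd (w : 'I_n) : (pos w < n)%N by [].
have mod1 (a : nat) : (a < n)%N ->
  (a.+1 < n)%N /\ (a.+1 %% n = a.+1)%N \/ a.+1 = n /\ (a.+1 %% n = 0)%N.
  rewrite leq_eqVlt => /orP[/eqP an|an]; [right|left]; split => //.
    by rewrite an modnn.
  by rewrite modn_small.
have pE w : (pos w + r < n)%N /\ pos' w = (pos w + r)%N :> nat \/
    (n <= pos w + r)%N /\ pos' w = (pos w + r - n)%N :> nat.
  by rewrite posE; case: ltnP; [left|right].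
split.
  move=> u v; rewrite /= => h; apply: cyc => /=; move: h.
  have := mod1 (pos u) (bd u); have := mod1 (pos' u) (ltn_ord _).
  by have := pE u; have := pE v; have := bd u; have := bd v; lia.
move=> a b c d ab cd [].
have ba : e b a by rewrite esym. have dc : e d c by rewrite esym.
have N1 := nc _ _ _ _ ab cd; have N2 := nc _ _ _ _ dc ab.
have N3 := nc _ _ _ _ ba dc; have N4 := nc _ _ _ _ cd ba.
move=> h1 h2 h3.
(* A crossing in the rotated order is one of the four cyclic shifts of a crossing in the old order;
   reversing or exchanging the edges reduces each to the forbidden pattern. *)
have : [|| [&& pos a < pos c, pos c < pos b & pos b < pos d],
   [&& pos d < pos a, pos a < pos c & pos c < pos b],
   [&& pos b < pos d, pos d < pos a & pos a < pos c] |
   [&& pos c < pos b, pos b < pos d & pos d < pos a]]%N.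
  clear - rn pE bd h1 h2 h3.
  have := bd a; have := bd b; have := bd c; have := bd d.
  by case: (pE a) => [[? ?]|[? ?]]; case: (pE b) => [[? ?]|[? ?]];
    case: (pE c) => [[? ?]|[? ?]]; case: (pE d) => [[? ?]|[? ?]]; lia.
by case/or4P=> /and3P[? ? ?]; [apply: N1|apply: N2|apply: N3|apply: N4].
Qed.

End Rotation.

Lemma rotation_exists (pos : {perm 'I_n}) (r : nat) : (r <= n)%N ->
  exists pos' : {perm 'I_n}, forall u,
    pos' u = (if pos u + r < n then pos u + r else pos u + r - n)%N :> nat.
Proof.
move=> rn.
have lt (u : 'I_n) : ((if pos u + r < n then pos u + r else pos u + r - n) < n)%N.
  by have := ltn_ord (pos u); case: ifP => //; lia.
pose f u := Ordinal (lt u).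
have finj : injective f.
  move=> u v /(congr1 val) /= h; apply: (@perm_inj _ pos); apply: val_inj.
  have := ltn_ord (pos u); have := ltn_ord (pos v); move: h.
  by case: ltnP => hu; case: ltnP => hv /=; lia.
by exists (perm finj) => u; rewrite permE.
Qed.

End Positions.

(** * Three chords around a face of the dual path *)

Section Dual.
Variables (n : nat) (e : rel 'I_n) (pos : {perm 'I_n}).
Hypotheses (n3 : (3 <= n)%N) (eG : simple_graph e).
Hypothesis emb : outerplane_embedding e pos.
Local Notation E := (pos_rel e pos).

Lemma pos_rel_sym i j : E i j -> E j i.
Proof. by move=> [u [v [ui vj uv]]]; exists v, u; split => //; rewrite eG.1. Qed.

Lemma pos_rel_lt i j : E i j -> (i < n)%N /\ (j < n)%N.
Proof. by move=> [u [v [<- <- _]]]; split; apply: ltn_ord. Qed.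

Lemma pos_rel_neq i j : E i j -> i <> j.
Proof.
move=> [u [v [<- <- uv]]] /val_inj/perm_inj uv'; move: uv; rewrite uv'.
by apply/negP; exact: eG.2.
Qed.

Lemma pos_rel_succ i : (i.+1 < n)%N -> E i i.+1.
Proof.
move=> lt; have [u ui] := pos_surj pos (ltnW lt); have [v vj] := pos_surj pos lt.
by exists u, v; split => //; apply: emb.1; rewrite ui vj modn_small.
Qed.

Lemma pos_rel_root : E 0%N n.-1.
Proof.
apply: pos_rel_sym; have h0 : (0 < n)%N by lia. have h1 : (n.-1 < n)%N by lia.
have [u ui] := pos_surj pos h1; have [v vj] := pos_surj pos h0.
by exists u, v; split => //; apply: emb.1; rewrite ui vj prednK // modnn.
Qed.

Lemma pos_rel_nocross a b c d : E a b -> E c d -> (a < c)%N -> (c < b)%N ->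
  (b < d)%N -> False.
Proof.
move=> [u [v [<- <- uv]]] [u' [v' [<- <- uv']]] h1 h2 h3.
by apply: (emb.2 _ _ _ _ uv uv'); split.
Qed.

(* The vertices of the face lying just inside the arc [lo, hi] of the outer
   cycle cut off by the edge {lo, hi}. *)
Definition visible lo hi z := (lo <= z <= hi)%N /\
  forall a b, E a b -> (lo <= a)%N -> (a < z)%N -> (z < b)%N -> (b <= hi)%N ->
    a = lo /\ b = hi.

Lemma visible_lo lo hi : (lo <= hi)%N -> visible lo hi lo.
Proof. by move=> h; split=> [|a b _ h1 h2]; lia. Qed.

Lemma visible_hi lo hi : (lo <= hi)%N -> visible lo hi hi.
Proof. by move=> h; split=> [|a b _ h1 h2 h3 h4]; lia. Qed.

(** An edge hiding [b] cannot cross [x b], so it starts at or before [x]; since it does not hide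
    [x], it starts at [x]. *)
Lemma visible_extend lo hi x b : visible lo hi x -> E x b -> (x < b)%N -> (b < hi)%N ->
  ~ visible lo hi b -> exists b', [/\ E x b', (b < b')%N, (b' <= hi)%N & (x, b') <> (lo, hi)].
Proof.
move=> [xlh vx] xb ltx lth nvb; apply: contrapT => nex; apply: nvb; split; first by lia.
move=> a' b' ab h1 h2 h3 h4; apply: contrapT => ne.
have ax : (a' <= x)%N.
  by rewrite leqNgt; apply/negP => xa; apply: (pos_rel_nocross xb ab).
move: ax; rewrite leq_eqVlt => /orP[/eqP ax|ax].
  by subst a'; apply: nex; exists b'; split => //; case=> ? ?; apply: ne.
by apply: ne; apply: (vx _ _ ab) => //; lia.
Qed.

Lemma visible_edge lo hi x y : E lo hi -> (lo < hi)%N -> visible lo hi x ->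
  visible lo hi y -> (x < y)%N ->
  (E x y <->
    (forall z, (z < n)%N -> visible lo hi z -> (x < z)%N -> (z < y)%N -> False) \/
    (forall z, (z < n)%N -> visible lo hi z -> (x <= z)%N /\ (z <= y)%N)).
Proof.
move=> Elh lh vx vy xy; have [lon hin] := pos_rel_lt Elh.
have [[xlh _] [ylh _]] := (vx, vy).
split=> [Exy|].
  have [[-> ->]|ne] := pselect (x = lo /\ y = hi).
    by right=> z _ [] /andP[].
  left=> z _ [zlh vz] xz zy; apply: ne.
  by apply: (vz _ _ Exy) => //; lia.
move=> [gap|all]; last first.
  have [h1 _] := all lo lon (visible_lo (ltnW lh)).
  have [_ h2] := all hi hin (visible_hi (ltnW lh)).
  have -> : x = lo by lia.
  by have -> : y = hi by lia.
(* Starting with the outer edge at [x], pass to longer and longer edges at [x]. Each hidden end can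
   be extended, none overshoots the visible [y], and nothing visible lies before [y]. *)
have H d : forall b, (y - b = d)%N -> E x b -> (x < b)%N -> (b <= y)%N -> E x y.
  elim/ltn_ind: d => d IH b bd xb ltxb.
  rewrite leq_eqVlt => /orP[/eqP<-//|lby].
  have bhi : (b < hi)%N by lia.
  have nvb : ~ visible lo hi b.
    by move=> vb; apply: (gap b) => //; lia.
  have [b' [xb' bb' b'hi ne]] := visible_extend vx xb ltxb bhi nvb.
  have b'y : (b' <= y)%N.
    rewrite leqNgt; apply/negP => yb'; apply: ne.
    by have [-> ->] := vy.2 _ _ xb' ltac:(lia) xy yb' b'hi.
  by apply: (IH (y - b')%N _ b') => //; lia.
apply: (H (y - x.+1)%N x.+1) => //.
by apply: pos_rel_succ; lia.
Qed.

Lemma visible_between lo hi : E lo hi -> (lo.+1 < hi)%N ->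
  exists z, [/\ visible lo hi z, (lo < z)%N & (z < hi)%N].
Proof.
move=> Elh lh; have [lon hin] := pos_rel_lt Elh.
have vlo : visible lo hi lo by apply: visible_lo; lia.
have H d : forall b, (hi - b = d)%N -> E lo b -> (lo < b)%N -> (b < hi)%N ->
    exists z, [/\ visible lo hi z, (lo < z)%N & (z < hi)%N].
  elim/ltn_ind: d => d IH b bd xb ltxb lby.
  have [vb|nvb] := pselect (visible lo hi b); first by exists b.
  have [b' [xb' bb' b'hi ne]] := visible_extend vlo xb ltxb lby nvb.
  have b'h : (b' < hi)%N.
    rewrite ltn_neqAle b'hi andbT; apply/eqP => e'; apply: ne; by rewrite e'.
  by apply: (IH (hi - b')%N _ b') => //; lia.
apply: (H (hi - lo.+1)%N lo.+1) => //.
by apply: pos_rel_succ; lia.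
Qed.

(** The outer edge between positions 0 and [n.-1] counts as a chord. The face just inside it is the
    root of the weak dual, and [chord_face] attaches a face to every chord. *)
Definition chord a b := E a b /\ (a.+1 < b)%N.
Definition chord_face lo hi : {set 'I_n} := pos_set pos (visible lo hi).

Lemma chord_face_internal lo hi : chord lo hi ->
  internal_face e pos (chord_face lo hi).
Proof.
move=> [Elh lh]; have [lon hin] := pos_rel_lt Elh.
have lh' : (lo <= hi)%N by lia.
apply: internal_face_pos; first exact: eG.1.
  have [z [vz lz zh]] := visible_between Elh lh.
  apply: (@card_pos_set _ pos _ [:: lo; z; hi]).
    by rewrite /= !inE; lia.
  move=> i; rewrite !inE => /or3P[] /eqP->; split => //.
  - exact: visible_lo.
  - by lia.
  - exact: visible_hi.
by move=> x y xy yn vx vy; apply: visible_edge => //; lia.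
Qed.

Lemma chord_face_inj lo hi lo' hi' : chord lo hi -> chord lo' hi' ->
  chord_face lo hi = chord_face lo' hi' -> lo = lo' /\ hi = hi'.
Proof.
have sub a b c d : chord a b -> chord_face a b = chord_face c d ->
    (c <= a)%N /\ (b <= d)%N.
  move=> [Eab ab] eF; have [an bn] := pos_rel_lt Eab.
  have [u ua] := pos_surj pos an; have [v vb] := pos_surj pos bn.
  have : u \in chord_face a b by apply/in_pos_set; rewrite ua; apply: visible_lo; lia.
  have : v \in chord_face a b by apply/in_pos_set; rewrite vb; apply: visible_hi; lia.
  rewrite eF => /in_pos_set[+ _] /in_pos_set[+ _].
  by rewrite /= ua vb; lia.
by move=> h h' eF; have := sub _ _ _ _ h eF; have := sub _ _ _ _ h' (esym eF); lia.
Qed.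

Definition nested lo hi a b :=
  [/\ (lo <= a)%N, (b <= hi)%N & (a, b) <> (lo, hi)].

(** The parent-child relation of the rooted weak dual: [a b] is a maximal chord strictly under
    [lo hi]. *)
Definition covers lo hi a b := [/\ chord lo hi, chord a b, nested lo hi a b &
  forall c d, chord c d -> (c <= a)%N -> (b <= d)%N -> nested lo hi c d -> (c, d) = (a, b)].

Lemma covers_adjacent lo hi a b : covers lo hi a b ->
  faces_adjacent e (chord_face lo hi) (chord_face a b).
Proof.
move=> [clh cab [la bh ne] mx]; split.
  apply/eqP => eF; apply: ne.
  by have [-> ->] := chord_face_inj clh cab eF.
have [[Elh lh] [Eab ab]] := (clh, cab).
have [an bn] := pos_rel_lt Eab.
have [u ua] := pos_surj pos an; have [v vb] := pos_surj pos bn.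
(* An edge hiding [a] or [b] would be a chord lying between [a b] and [lo hi], against
   maximality. *)
have key c d z : E c d -> (lo <= c)%N -> (c < z)%N -> (z < d)%N -> (d <= hi)%N ->
    z = a \/ z = b -> c = lo /\ d = hi.
  move=> Ecd lc cz zd dh zab; apply: contrapT => n1.
  have ccd : chord c d by split => //; lia.
  have ncd : nested lo hi c d by split => //; case=> ? ?; apply: n1.
  have ca : (c <= a)%N.
    rewrite leqNgt; apply/negP => ac; case: zab => zE; subst z; first by lia.
    exact: (pos_rel_nocross Eab Ecd).
  have bd : (b <= d)%N.
    rewrite leqNgt; apply/negP => db; case: zab => zE; subst z; last by lia.
    exact: (pos_rel_nocross Ecd Eab).
  by have [? ?] := mx _ _ ccd ca bd ncd; lia.
exists u, v; split.
- apply/setIP; split; apply/in_pos_set; rewrite ua; last by apply: visible_lo; lia.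
  by split=> [|c d Ecd h1 h2 h3 h4]; [lia | apply: key h3 h4 _ => //; left].
- apply/setIP; split; apply/in_pos_set; rewrite vb; last by apply: visible_hi; lia.
  by split=> [|c d Ecd h1 h2 h3 h4]; [lia | apply: key h3 h4 _ => //; right].
- by apply/(pos_relE e pos); rewrite /= ua vb.
Qed.

Lemma covers_below lo hi a b : chord lo hi -> chord a b -> nested lo hi a b ->
  exists c d, [/\ covers lo hi c d, (c <= a)%N & (b <= d)%N].
Proof.
move=> clh; move: {2}(hi - lo - (b - a))%N (erefl (hi - lo - (b - a))%N) => D.
elim/ltn_ind: D a b => D IH a b De cab nab.
have [[c [d [ccd ca bd ncd ne]]]|nex] := pselect (exists c d,
    [/\ chord c d, (c <= a)%N, (b <= d)%N, nested lo hi c d & (c, d) <> (a, b)]).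
  have lt : (b - a < d - c)%N.
    have [_ ab] := cab; have : ~ (c = a /\ d = b) by case=> ? ?; apply: ne; congr pair.
    by lia.
  have [lc dh _] := ncd; have [_ cd] := ccd.
  have [|c' [d' [h1 h2 h3]]] := IH (hi - lo - (d - c))%N _ c d erefl ccd ncd; first by lia.
  by exists c', d'; split => //; lia.
exists a, b; split => //; split => // c d ccd ca bd ncd.
by apply: contrapT => ne; apply: nex; exists c, d.
Qed.

Lemma covers_above lo hi a b : chord lo hi -> chord a b -> nested lo hi a b ->
  exists c d, covers c d a b.
Proof.
move: {2}(hi - lo)%N (erefl (hi - lo)%N) => D.
elim/ltn_ind: D lo hi => D IH lo hi De clh cab nab.
have [[c [d [ccd ca bd ncd ne]]]|nex] := pselect (exists c d,
    [/\ chord c d, (c <= a)%N, (b <= d)%N, nested lo hi c d & (c, d) <> (a, b)]).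
  have [lc dh ne'] := ncd; have [_ cd] := ccd.
  have lt : (d - c < hi - lo)%N.
    have : ~ (c = lo /\ d = hi) by case=> ? ?; apply: ne'; congr pair.
    by lia.
  apply: (IH (d - c)%N _ c d) => //; first by rewrite -De.
  by split => //; apply/nesym.
exists lo, hi; split => // c d ccd ca bd ncd.
by apply: contrapT => ne; apply: nex; exists c, d.
Qed.

Lemma chord_root : chord 0 n.-1.
Proof. by split; [exact: pos_rel_root | lia]. Qed.

Lemma chord_nested_root a b : chord a b -> (a, b) <> (0%N, n.-1) -> nested 0 n.-1 a b.
Proof. by move=> [/pos_rel_lt[_ bn] _] ne; split => //; lia. Qed.

Lemma faces_adjacentC (F G : {set 'I_n}) : faces_adjacent e F G -> faces_adjacent e G F.
Proof.
move=> [ne [u [v [uF vF uv]]]]; split; first by rewrite eq_sym.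
by exists u, v; rewrite finset.setIC.
Qed.

Hypothesis dual : weak_dual_is_path e pos.

(** In a path every neighbour of [F] has an index one above or one below that of [F], which leaves
    two places for three faces. *)
Lemma dual_degree (F G1 G2 G3 : {set 'I_n}) :
  internal_face e pos F -> internal_face e pos G1 -> internal_face e pos G2 ->
  internal_face e pos G3 -> faces_adjacent e F G1 -> faces_adjacent e F G2 ->
  faces_adjacent e F G3 -> G1 != G2 -> G1 != G3 -> G2 != G3 -> False.
Proof.
have [s [us sP adj]] := dual.
move=> /sP Fs /sP s1 /sP s2 /sP s3 a1 a2 a3 n12 n13 n23.
have step G : G \in s -> faces_adjacent e F G ->
    ((index F s).+1 == index G s) || ((index G s).+1 == index F s).
  by move=> Gs aG; apply/adj; rewrite ?index_mem ?nth_index.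
have idx G G' : G \in s -> G' \in s -> G != G' -> index G s != index G' s.
  move=> Gs Gs'; apply: contra => /eqP ei.
  by rewrite -(nth_index finset.set0 Gs) ei nth_index.
have := step _ s1 a1; have := step _ s2 a2; have := step _ s3 a3.
have := idx _ _ s1 s2 n12; have := idx _ _ s1 s3 n13; have := idx _ _ s2 s3 n23.
by lia.
Qed.

Lemma chord_degree lo hi (a b c d g h : nat) :
  chord lo hi -> chord a b -> chord c d -> chord g h ->
  faces_adjacent e (chord_face lo hi) (chord_face a b) ->
  faces_adjacent e (chord_face lo hi) (chord_face c d) ->
  faces_adjacent e (chord_face lo hi) (chord_face g h) ->
  (a, b) <> (c, d) -> (a, b) <> (g, h) -> (c, d) <> (g, h) -> False.
Proof.
move=> c0 c1 c2 c3 a1 a2 a3 n1 n2 n3'.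
apply: (dual_degree (chord_face_internal c0) (chord_face_internal c1)
  (chord_face_internal c2) (chord_face_internal c3) a1 a2 a3); apply/eqP => eF.
- by apply: n1; have [-> ->] := chord_face_inj c1 c2 eF.
- by apply: n2; have [-> ->] := chord_face_inj c1 c3 eF.
- by apply: n3'; have [-> ->] := chord_face_inj c2 c3 eF.
Qed.

(** Descend as long as one child contains both chords. Where they separate, a face has two children
    and, not being the root, also a parent: degree three. *)
Lemma no_two_inside lo hi a b c d : chord lo hi -> (lo, hi) <> (0%N, n.-1) ->
  chord a b -> chord c d -> (lo <= a)%N -> (b <= c)%N -> (d <= hi)%N -> False.
Proof.
move: {2}(hi - lo)%N (erefl (hi - lo)%N) => D.
elim/ltn_ind: D lo hi => D IH lo hi De clh nroot cab ccd la bc dh.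
have [[_ ab] [_ cd]] := (cab, ccd).
have nab : nested lo hi a b by split; [lia|lia|case=> ? ?; lia].
have ncd : nested lo hi c d by split; [lia|lia|case=> ? ?; lia].
have [p [q [cpq pa bq]]] := covers_below clh cab nab.
have [p' [q' [cpq' pc dq]]] := covers_below clh ccd ncd.
have [_ ppq [lp qh npq] _] := cpq; have [_ ppq' _ _] := cpq'.
have [[e1 e2]|ne] := pselect (p = p' /\ q = q').
  subst p' q'; apply: (IH (q - p)%N _ p q) => //.
    have : ~ (p = lo /\ q = hi) by case=> ? ?; apply: npq; congr pair.
    by have [_ ?] := ppq; lia.
  case=> p0 q0; apply: npq; congr pair; have [/pos_rel_lt[_ hn] _] := clh; lia.
have [u [v cuv]] := covers_above chord_root clh (chord_nested_root clh nroot).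
have [puv _ [ul hv nuv] _] := cuv; have [_ uv] := puv.
apply: (chord_degree clh ppq ppq' puv (covers_adjacent cpq) (covers_adjacent cpq')
  (faces_adjacentC (covers_adjacent cuv))).
- by case=> ? ?; apply: ne.
- by case=> ? ?; apply: nuv; congr pair; lia.
- have [_ _ [lp' qh' npq'] _] := cpq'.
  by case=> ? ?; apply: nuv; congr pair; lia.
Qed.

(** The root has no parent, so it may have two children but not three; if two of the chords are
    under the same child, [no_two_inside] applies there. *)
Lemma no_three_disjoint a b c d g h : chord a b -> chord c d -> chord g h ->
  (b <= c)%N -> (d <= g)%N -> False.
Proof.
move=> cab ccd cgh bc dg; have croot := chord_root.
have [[/pos_rel_lt[_ bn] ab] [/pos_rel_lt[_ dn] cd]] := (cab, ccd).
have [/pos_rel_lt[_ hn] gh] := cgh.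
have below x y : chord x y -> (0 < x)%N \/ (y < n.-1)%N -> exists p q,
    [/\ covers 0 n.-1 p q, (p <= x)%N & (y <= q)%N].
  move=> cxy hxy; apply: covers_below => //; apply: chord_nested_root => //.
  by case=> ? ?; lia.
have [p1 [q1 [C1 h1 h1']]] := below _ _ cab ltac:(lia).
have [p2 [q2 [C2 h2 h2']]] := below _ _ ccd ltac:(lia).
have [p3 [q3 [C3 h3 h3']]] := below _ _ cgh ltac:(lia).
have [_ c1 [_ _ n1] _] := C1; have [_ c2 [_ _ n2] _] := C2; have [_ c3 [_ _ n3'] _] := C3.
apply: (chord_degree croot c1 c2 c3 (covers_adjacent C1) (covers_adjacent C2)
  (covers_adjacent C3)).
- case=> e1 e2; subst p2 q2; apply: (no_two_inside c1 n1 cab ccd) => //.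
- case=> e1 e2; subst p3 q3; apply: (no_two_inside c1 n1 cab cgh) => //; lia.
- case=> e1 e2; subst p3 q3; apply: (no_two_inside c2 n2 ccd cgh) => //.
Qed.

End Dual.

Lemma least_pair (f : nat -> nat -> nat) (Q : nat -> nat -> Prop) :
  (exists a b, Q a b) ->
  exists a b, Q a b /\ forall c d, Q c d -> (f a b <= f c d)%N.
Proof.
move=> [a [b]]; move: {2}(f a b) (erefl (f a b)) => D.
elim/ltn_ind: D a b => D IH a b De Qab.
have [[c [d [Qcd lt]]]|nex] := pselect (exists c d, Q c d /\ (f c d < f a b)%N).
  by apply: (IH (f c d) _ c d) => //; rewrite -De.
exists a, b; split => // c d Qcd; rewrite leqNgt; apply/negP => lt.
by apply: nex; exists c, d.
Qed.

Section Gates.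
Variables (n : nat) (e : rel 'I_n) (pos : {perm 'I_n}).
Hypotheses (n3 : (3 <= n)%N) (eG : simple_graph e).
Hypothesis emb : outerplane_embedding e pos.
Hypothesis dual : weak_dual_is_path e pos.
Local Notation E := (pos_rel e pos).
Local Notation chord := (chord e pos).

(* Outer edge number [i] joins the positions [i] and [i + 1 mod n]. *)
Lemma two_gates : exists al be, [/\ (al < be)%N, (be < n)%N &
  forall a b, chord a b -> (a, b) <> (0%N, n.-1) ->
    (a <= al < b)%N != (a <= be < b)%N].
Proof.
pose Q a b := chord a b /\ (a, b) <> (0%N, n.-1).
have Qlt a b : Q a b -> (a.+1 < b < n)%N.
  by move=> [[/pos_rel_lt[_ bn] ab] _]; apply/andP.
have cross a b c d : Q a b -> Q c d -> [|| b <= c, d <= a, (a <= c) && (d <= b) |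
    (c <= a) && (b <= d)]%N.
  move=> qab qcd; have := Qlt _ _ qab; have := Qlt _ _ qcd.
  have h1 := pos_rel_nocross emb qab.1.1 qcd.1.1.
  have h2 := pos_rel_nocross emb qcd.1.1 qab.1.1.
  by lia.
have two a b c d g h : Q g h -> Q a b -> Q c d -> (g <= a)%N -> (b <= c)%N ->
    (d <= h)%N -> False.
  by move=> [q1 q2] [q3 _] [q4 _]; exact: (no_two_inside n3 eG emb dual q1 q2 q3 q4).
have three a b c d g h : Q a b -> Q c d -> Q g h -> (b <= c)%N -> (d <= g)%N -> False.
  by move=> [q1 _] [q3 _] [q4 _]; exact: (no_three_disjoint n3 eG emb dual q1 q3 q4).
have [exQ|nQ] := pselect (exists a b, Q a b); last first.
  exists 0%N, n.-1; split; [by lia | by lia |].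
  by move=> a b cab nab; exfalso; apply: nQ; exists a, b.
(* A shortest chord cuts off a leaf face; its first outer edge is one gate. *)
have [a [b [Qab mab]]] := least_pair (fun a b => b - a)%N exQ.
have lab := Qlt _ _ Qab.
have [exQ'|nQ'] := pselect (exists c d, Q c d /\ ~~ (c <= a < d)%N); last first.
  (* All chords are nested around the first gate. The outer edge closing the cycle is under none of
     them and serves as the other gate. *)
  exists a, n.-1; split; [by lia | by lia |]; move=> x y cxy nxy.
  have Qxy : Q x y by [].
  have := Qlt _ _ Qxy; have : (x <= a < y)%N.
    by apply: contrapT => h; apply: nQ'; exists x, y; split => //; apply/negP.
  by lia.
have [c [d [[Qcd nac] mcd]]] := least_pair (fun a b => b - a)%N exQ'.
have lcd := Qlt _ _ Qcd.
have disj : (b <= c)%N \/ (d <= a)%N.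
  by have := cross _ _ _ _ Qab Qcd; have := mab _ _ Qcd; lia.
(* By minimality, a chord over a gate is over the whole chord defining that gate. Over both gates it
   contradicts [two]; over neither, the three chords are disjoint and contradict [three]. *)
have key x y : Q x y -> (x <= a < y)%N != (x <= c < y)%N.
  move=> Qxy; have lxy := Qlt _ _ Qxy.
  have xab := cross _ _ _ _ Qab Qxy; have xcd := cross _ _ _ _ Qcd Qxy.
  have mxy := mab _ _ Qxy.
  have mxy' : ~~ (x <= a < y)%N -> (d - c <= y - x)%N by move=> h; apply: mcd.
  apply/eqP => eq; have [ha|ha] := boolP (x <= a < y)%N.
    have hc : (x <= c < y)%N by rewrite -eq.
    have [s1 s2] : ((x <= a) && (b <= y) /\ (x <= c) && (d <= y))%N by lia.
    by case: disj => h; [apply: (two a b c d x y) | apply: (two c d a b x y)] => //; lia.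
  have hc : ~~ (x <= c < y)%N by rewrite -eq.
  have {}mxy' := mxy' ha.
  have s1 : (b <= x)%N \/ (y <= a)%N by lia.
  have s2 : (d <= x)%N \/ (y <= c)%N by lia.
  case: disj => h; case: s1 => h1; case: s2 => h2.
  - by apply: (three a b c d x y).
  - by apply: (three a b x y c d).
  - by lia.
  - by apply: (three x y a b c d).
  - by apply: (three c d a b x y).
  - by lia.
  - by apply: (three c d x y a b).
  - by apply: (three x y c d a b).
have [ac|ca|ac] := ltngtP a c; last by lia.
  by exists a, c; split => //; [lia | move=> x y cxy nxy; apply: key].
by exists c, a; split => //; [lia | move=> x y cxy nxy; rewrite eq_sym; apply: key].
Qed.

(** The gates cut the outer cycle into two arcs, and a chord over exactly one gate has an end on
    each. So edges within an arc belong to the outer cycle. *)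
Lemma strip_position : exists (pos' : {perm 'I_n}) T, [/\ (T.+1 < n)%N,
  outerplane_embedding e pos',
  forall F, internal_face e pos' F -> internal_face e pos F &
  forall u v, e u v -> (pos' u < pos' v)%N -> (pos' u <= T)%N = (pos' v <= T)%N ->
    pos' v = (pos' u).+1 :> nat].
Proof.
have [al [be [ab bn gate]]] := two_gates.
have rn : (n - al.+1 <= n)%N by lia.
(* The end of gate [al] moves to position 0, so that this gate joins [n.-1] to 0 and gate [be] joins
   [T] to [T.+1]. *)
have [pos' posE] := rotation_exists pos rn.
have n0 : (0 < n)%N by lia.
exists pos', (be - al.+1)%N; split; first by lia.
- exact: rotation_embedding rn posE n0 eG.1 emb.
- by move=> F; apply: (rotation_internal_face rn posE).
have pE w : (pos w < al.+1)%N /\ pos' w = (pos w + (n - al.+1))%N :> nat \/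
    (al.+1 <= pos w)%N /\ pos' w = (pos w - al.+1)%N :> nat.
  have h2 := ltn_ord (pos w); rewrite posE.
  by case: (ltnP (pos w + (n - al.+1)) n) => h1; [left|right]; lia.
have W u v : e u v -> (pos u < pos v)%N -> pos v = (pos u).+1 :> nat \/
    (pos u = 0%N :> nat /\ pos v = n.-1 :> nat) \/
    (pos u <= al < pos v)%N != (pos u <= be < pos v)%N.
  move=> euv uv; have Euv : E (pos u) (pos v) by apply/pos_relE.
  have [h|h] := leqP (pos v) (pos u).+1; first by left; lia.
  right; have [[h1 h2]|ne] := pselect (pos u = 0%N :> nat /\ pos v = n.-1 :> nat).
    by left.
  by right; apply: gate => //; case=> ? ?; apply: ne.
move=> u v euv.
have ne : pos u <> pos v :> nat by apply: (pos_rel_neq eG); apply/pos_relE.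
have evu : e v u by rewrite eG.1.
have Wuv := W u v euv; have Wvu := W v u evu.
have := pE u; have := pE v; have := ltn_ord (pos u); have := ltn_ord (pos v).
clear - Wuv Wvu ne ab bn n3.
move=> bu bv [[h1 ->]|[h1 ->]] [[h2 ->]|[h2 ->]] lt side; lia.
Qed.

End Gates.

(** * The strip of an outerpath *)

(** Monotonicity makes the sum [a + b] a faithful linear order on [C]; always taking the next
    smallest sum skips no pair. *)
Lemma chain_exists (C : nat -> nat -> Prop) (T S : nat) :
  (forall a b a' b', C a b -> C a' b' -> (a + b <= a' + b')%N -> (a <= a' /\ b <= b')%N) ->
  C T S -> (forall a b, C a b -> (a + b <= T + S)%N) ->
  forall a0 b0, C a0 b0 -> exists m (A B : nat -> nat),
    [/\ (A 0%N, B 0%N) = (a0, b0), (A m, B m) = (T, S),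
        forall i, (i <= m)%N -> C (A i) (B i) &
        forall i, (i < m)%N ->
          [/\ (A i <= A i.+1)%N, (B i <= B i.+1)%N, (A i + B i < A i.+1 + B i.+1)%N &
              forall a b, C a b -> (a + b <= A i + B i)%N \/ (A i.+1 + B i.+1 <= a + b)%N]].
Proof.
move=> mono CT CS a0 b0.
move: {2}(T + S - (a0 + b0))%N (erefl (T + S - (a0 + b0))%N) => D.
elim/ltn_ind: D a0 b0 => D IH a0 b0 De C0; have le0 := CS _ _ C0.
have [e|ne] := eqVneq (a0 + b0)%N (T + S)%N.
  have [h1 h2] := mono _ _ _ _ C0 CT le0.
  exists 0%N, (fun=> a0), (fun=> b0); split => //.
  by have [-> ->] : a0 = T /\ b0 = S by split; lia.
have exQ : exists a b, C a b /\ (a0 + b0 < a + b)%N by exists T, S; split => //; lia.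
have [a1 [b1 [[C1 lt1] min1]]] := least_pair addn exQ.
have le1 := CS _ _ C1.
have [|m [A [B [[A0 B0] [Am Bm] CAB step]]]] := IH (T + S - (a1 + b1))%N _ a1 b1 erefl C1.
  by lia.
exists m.+1, (fun i => if i is j.+1 then A j else a0),
  (fun i => if i is j.+1 then B j else b0); split => //.
- by rewrite Am Bm.
- by case.
- case=> [|i] im; last exact: step.
  rewrite A0 B0; have [h1 h2] := mono _ _ _ _ C0 C1 (ltnW lt1).
  split => // a b Cab; have [h|h] := leqP (a + b) (a0 + b0); first by left.
  by right; apply: min1.
Qed.

Lemma step_locate (f : nat -> nat) m a : (f 0 <= a)%N -> (a < f m)%N ->
  exists2 i, (i < m)%N & (f i <= a < f i.+1)%N.
Proof.
move=> f0; elim: m => [|m IH] am; first by move: am; rewrite ltnNge f0.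
have [lt|le] := ltnP a (f m); last by exists m; rewrite ?le.
by have [i im h] := IH lt; exists i => //; apply: ltnW.
Qed.

Section Strip.
Variables (n : nat) (e : rel 'I_n) (pos : {perm 'I_n}) (T : nat).
Hypotheses (n3 : (3 <= n)%N) (eG : simple_graph e).
Hypothesis emb : outerplane_embedding e pos.
Hypothesis Tn : (T.+1 < n)%N.
Hypothesis side : forall u v, e u v -> (pos u < pos v)%N ->
  (pos u <= T)%N = (pos v <= T)%N -> pos v = (pos u).+1 :> nat.
Local Notation E := (pos_rel e pos).

(* The bottom vertices are counted from the left, hence backwards along the
   outer cycle. *)
Definition cross_edge a b := [/\ (a <= T)%N, (b <= n.-1 - T.+1)%N & E a (n.-1 - b)%N].

Definition strip_lab (v : 'I_n) : lab :=
  if (pos v <= T)%N then (true, val (pos v)) else (false, (n.-1 - pos v)%N).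

Lemma side_succ i j : E i j -> (i < j)%N -> (i <= T)%N = (j <= T)%N -> j = i.+1.
Proof. by move=> [u [v [<- <- uv]]]; exact: side. Qed.

Lemma cross_edge_mono a b a' b' : cross_edge a b -> cross_edge a' b' ->
  (a + b <= a' + b')%N -> (a <= a' /\ b <= b')%N.
Proof.
move=> [aT bS Eab] [aT' bS' Eab'] le.
have h1 := pos_rel_nocross emb Eab Eab'; have h2 := pos_rel_nocross emb Eab' Eab.
by split; lia.
Qed.

Lemma cross_edge_first : cross_edge 0 0.
Proof.
split=> //; rewrite subn0.
have h0 : (0 < n)%N by lia. have h1 : (n.-1 < n)%N by lia.
apply: (pos_rel_sym eG).
have [u ui] := pos_surj pos h1; have [v vj] := pos_surj pos h0.
by exists u, v; split => //; apply: emb.1; rewrite ui vj prednK // modnn.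
Qed.

Lemma cross_edge_last : cross_edge T (n.-1 - T.+1).
Proof.
split=> //; have -> : (n.-1 - (n.-1 - T.+1) = T.+1)%N by lia.
exact: (pos_rel_succ emb).
Qed.

Lemma strip_chain : exists m (A B : nat -> nat),
    [/\ (A 0%N, B 0%N) = (0%N, 0%N), (A m, B m) = (T, (n.-1 - T.+1)%N),
        forall i, (i <= m)%N -> cross_edge (A i) (B i) &
        forall i, (i < m)%N ->
          [/\ (A i <= A i.+1)%N, (B i <= B i.+1)%N, (A i + B i < A i.+1 + B i.+1)%N &
              forall a b, cross_edge a b ->
                (a + b <= A i + B i)%N \/ (A i.+1 + B i.+1 <= a + b)%N]].
Proof.
apply: chain_exists; [exact: cross_edge_mono|exact: cross_edge_last| |exact: cross_edge_first].
by move=> a b [? ? _]; lia.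
Qed.

Section Chain.
Variables (m : nat) (A B : nat -> nat).
Hypothesis AB0 : (A 0%N, B 0%N) = (0%N, 0%N).
Hypothesis ABm : (A m, B m) = (T, (n.-1 - T.+1)%N).
Hypothesis ABC : forall i, (i <= m)%N -> cross_edge (A i) (B i).
Hypothesis ABS : forall i, (i < m)%N ->
  [/\ (A i <= A i.+1)%N, (B i <= B i.+1)%N, (A i + B i < A i.+1 + B i.+1)%N &
      forall a b, cross_edge a b ->
        (a + b <= A i + B i)%N \/ (A i.+1 + B i.+1 <= a + b)%N].

Lemma cross_edge_chord a b : cross_edge a b ->
  exists2 i, (i <= m)%N & (A i, B i) = (a, b).
Proof.
move=> Cab; have [A0 B0] := AB0; have [Am Bm] := ABm.
have [aT bS _] := Cab.
have [e'|ne] := eqVneq (a + b)%N (A m + B m)%N.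
  exists m => //; congr pair; lia.
have [||i im /andP[h1 h2]] := @step_locate (fun i => A i + B i)%N m (a + b).
- by rewrite A0 B0.
- by rewrite Am Bm in ne *; lia.
exists i; first exact: ltnW.
have [_ _ _ /(_ a b Cab) h] := ABS im.
have eS : (a + b = A i + B i)%N by lia.
have [g1 g2] := cross_edge_mono Cab (ABC (ltnW im)) (eq_leq eS).
by congr pair; lia.
Qed.

Lemma strip_edge u v : e u v <-> exists2 i, (i < m)%N &
  face_edge A B i (strip_lab u) (strip_lab v) || face_edge A B i (strip_lab v) (strip_lab u).
Proof.
have bd (w : 'I_n) : (pos w < n)%N by [].
have [A0 B0] := AB0; have [Am Bm] := ABm.
have m0 : (0 < m)%N.
  by case: (posnP m) => // m0; move: Am Bm; rewrite m0 A0 B0; lia.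
split.
  wlog lt : u v / (pos u < pos v)%N.
    move=> W euv; have ne : pos u <> pos v :> nat.
      by apply: (pos_rel_neq eG); apply/pos_relE.
    have [lt|lt|//] := ltngtP (pos u) (pos v); first exact: W.
    by have [|i im h] := W v u lt; [rewrite eG.1 | exists i => //; rewrite orbC].
  move=> euv; have Euv : E (pos u) (pos v) by apply/pos_relE.
  rewrite /strip_lab; have [uT|uT] := leqP (pos u) T; have [vT|vT] := leqP (pos v) T.
  - have := side euv lt; rewrite uT vT => /(_ erefl) vE.
    have [||i im h] := @step_locate A m (pos u); rewrite ?A0 ?Am //; first by lia.
    by exists i => //; apply/orP; right; rewrite /= vE eqxx.
  - have Cuv : cross_edge (pos u) (n.-1 - pos v).
      have bv := bd v; split=> //; first by lia.
      by have -> : (n.-1 - (n.-1 - pos v) = pos v)%N by lia.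
    have [i im [eA eB]] := cross_edge_chord Cuv.
    (* Chord [i] is the left chord of face [i], except the last one, which is only the right chord
       of face [m.-1]. *)
    move: im; rewrite leq_eqVlt => /orP[/eqP im|im]; last first.
      by exists i => //; rewrite /= -eA -eB !eqxx.
    exists m.-1; first by lia.
    by rewrite /= prednK // -im -eA -eB !eqxx orbT.
  - by lia.
  - have := side euv lt; rewrite leqNgt uT leqNgt vT => /(_ erefl) vE.
    have bv := bd v.
    have [||i im h] := @step_locate B m (n.-1 - pos v); rewrite ?B0 ?Bm //; first by lia.
    exists i => //; apply/orP; right; rewrite /= h andbT; lia.
have half w w' i : (i < m)%N -> face_edge A B i (strip_lab w) (strip_lab w') -> e w w'.
  move=> im; have bw := bd w; have bw' := bd w'.
  have [_ _ EA] := ABC (ltnW im); have [aT' bS' EA'] := ABC im.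
  rewrite /strip_lab; have [wT|wT] := leqP (pos w) T; have [wT'|wT'] := leqP (pos w') T => /=.
  - move=> /and3P[/eqP h _ _]; rewrite eG.1; apply/(pos_relE e pos); rewrite h.
    by apply: (pos_rel_succ emb); rewrite -h.
  - move=> /andP[/eqP h1 /eqP h2]; apply/(pos_relE e pos); rewrite h1.
    have -> : (pos w' : nat) = (n.-1 - B i)%N by lia.
    by [].
  - move=> /andP[/eqP h1 /eqP h2]; rewrite eG.1; apply/(pos_relE e pos); rewrite h2.
    have -> : (pos w : nat) = (n.-1 - B i.+1)%N by lia.
    by [].
  - move=> /and3P[/eqP h _ _]; rewrite eG.1; apply/(pos_relE e pos).
    have h' : (pos w : nat) = (pos w').+1 by lia.
    by rewrite h'; apply: (pos_rel_succ emb); rewrite -h'.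
by move=> [i im /orP[]/(half _ _ _ im)//]; rewrite eG.1.
Qed.

(** This transfers the bound on face sizes to the strip: the face of the drawing is an internal face
    of the graph. *)
Lemma strip_face i : (i < m)%N -> exists2 F, internal_face e pos F &
  ((A i.+1 - A i) + (B i.+1 - B i) + 2 <= #|F|)%N.
Proof.
move=> im; have [Ai Bi lt between] := ABS im.
have [aT bS Ei] := ABC (ltnW im); have [aT' bS' Ei'] := ABC im.
pose P z := ((A i <= z <= A i.+1) || (n.-1 - B i.+1 <= z <= n.-1 - B i))%N.
have card : ((A i.+1 - A i) + (B i.+1 - B i) + 2 <= #|pos_set pos P|)%N.
  pose s := iota (A i) (A i.+1 - A i).+1 ++ iota (n.-1 - B i.+1) (B i.+1 - B i).+1.
  have -> : ((A i.+1 - A i) + (B i.+1 - B i) + 2 = size s)%N.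
    by rewrite size_cat !size_iota; lia.
  apply: card_pos_set.
    rewrite cat_uniq !iota_uniq andbT andTb; apply/hasPn => z; rewrite !mem_iota.
    by lia.
  by move=> z; rewrite mem_cat !mem_iota /P => h; split; lia.
exists (pos_set pos P) => //; apply: internal_face_pos => //; first exact: eG.1.
  by apply: leq_trans card; lia.
have PA : P (A i) by rewrite /P leqnn Ai.
have PA' : P (A i.+1) by rewrite /P leqnn Ai.
have PB : P (n.-1 - B i)%N by rewrite /P; lia.
have PB' : P (n.-1 - B i.+1)%N by rewrite /P; lia.
have bA : (A i < n /\ A i.+1 < n /\ n.-1 - B i < n /\ n.-1 - B i.+1 < n)%N by lia.
have [bA1 [bA2 [bB1 bB2]]] := bA.
move=> x y xy yn Px Py.
have [xT|xT] := leqP x T; have [yT|yT] := leqP y T.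
- split=> [Exy|[gap|all]].
  + have yE := side_succ Exy xy; rewrite xT yT in yE; have {}yE := yE erefl.
    by left=> z _ _; lia.
  + have [e'|lt'] := eqVneq y x.+1; first by rewrite e'; apply: (pos_rel_succ emb); lia.
    by exfalso; apply: (gap x.+1); move: Px Py; rewrite /P; lia.
  + by have := all _ bB1 PB; lia.
- have [Px1 Py1] : ((A i <= x <= A i.+1) /\ (n.-1 - B i.+1 <= y <= n.-1 - B i))%N.
    by move: Px Py; rewrite /P; lia.
  (* The left chord encloses all positions of the face and the right chord has none strictly inside;
     [between] excludes any other cross edge. *)
  split=> [Exy|[gap|all]].
  + have Cxy : cross_edge x (n.-1 - y)%N.
      split => //; first by lia.
      by have -> : (n.-1 - (n.-1 - y) = y)%N by lia.
    case: (between _ _ Cxy) => h.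
      by right=> z zn; rewrite /P; lia.
    by left=> z zn; rewrite /P; lia.
  + have e1 : x = A i.+1.
      apply/eqP; apply: contraT => ne; exfalso; apply: (gap (A i.+1)) => //; lia.
    have e2 : y = (n.-1 - B i.+1)%N.
      apply/eqP; apply: contraT => ne; exfalso; apply: (gap (n.-1 - B i.+1)%N) => //; lia.
    by rewrite e1 e2.
  + have h1 := all _ bA1 PA; have h2 := all _ bB1 PB.
    have -> : x = A i by lia.
    by have -> : y = (n.-1 - B i)%N by lia.
- by lia.
- split=> [Exy|[gap|all]].
  + have yE := side_succ Exy xy; have {}yE : y = x.+1 by apply: yE; lia.
    by left=> z _ _; lia.
  + have [e'|lt'] := eqVneq y x.+1; first by rewrite e'; apply: (pos_rel_succ emb); lia.
    by exfalso; apply: (gap x.+1); move: Px Py; rewrite /P; lia.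
  + by have := all _ bA1 PA; lia.
Qed.

End Chain.
End Strip.

(** * Assembling the drawing *)

(** The term [s ^+ 2] is at most [k * k], and [k <= n] turns this into [n * k]; [M] bounds both the
    abscissae, in units of [2 * k], and the slopes. *)
Lemma side_point_bounds m A X q rho (n k i a : nat) (M : int) :
  side_layout m A X q rho -> (i < m)%N -> (A i <= a <= A i.+1)%N ->
  (A i.+1 - A i <= k)%N -> (k <= n)%N ->
  (forall j, (j <= m)%N -> 0 <= X j <= M /\ - M <= rho j <= M) ->
  let p := side_point m A (2 * k%:Z) X rho a in
  - (M * k%:Z) <= p.1 <= 3 * (M * k%:Z) + n%:Z * k%:Z /\ 0 <= p.2 <= k%:Z.
Proof.
move=> AX im /andP[Aa aA] tk kn bd.
have [/andP[Xi0 XiM] /andP[ri0 riM]] := bd i (ltnW im).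
have [/andP[Xj0 XjM] _] := bd i.+1 im.
have M0 : 0 <= M := le_trans Xi0 XiM.
have k0 : 0 <= k%:Z by [].
have Mk : 0 <= M * k%:Z by apply: mulr_ge0.
have nk : 0 <= n%:Z * k%:Z by apply: mulr_ge0.
move: aA; rewrite leq_eqVlt => /orP[/eqP ->|lt].
  rewrite (side_point_chord AX _ im); split; last by rewrite lexx.
  rewrite /fst.
  have : 0 <= k%:Z * (M - X i.+1) by apply: mulr_ge0; rewrite ?subr_ge0.
  have : 0 <= k%:Z * X i.+1 by apply: mulr_ge0.
  by move=> h1 h2; apply/andP; split; lra.
rewrite (side_point_face AX _ im Aa lt) /fst /snd.
have [s0 sk] : 0 <= a%:Z - (A i)%:Z /\ a%:Z - (A i)%:Z <= k%:Z by split; lia.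
move: (a%:Z - (A i)%:Z) s0 sk => s s0 sk; split; last by rewrite s0 sk.
have h1 : 0 <= k%:Z * (M - X i) by apply: mulr_ge0; rewrite ?subr_ge0.
have h2 : 0 <= k%:Z * X i by apply: mulr_ge0.
have h3 : 0 <= s * (k%:Z - s) by apply: mulr_ge0; rewrite ?subr_ge0.
have h4 : 0 <= (n%:Z - k%:Z) * k%:Z by apply: mulr_ge0; rewrite ?subr_ge0.
have h5 : 0 <= s * (M - rho i) by apply: mulr_ge0; rewrite ?subr_ge0.
have h6 : 0 <= s * (M + rho i) by apply: mulr_ge0 => //; lia.
have h7 : 0 <= M * (k%:Z - s) by apply: mulr_ge0; rewrite ?subr_ge0.
have h8 : 0 <= k%:Z * (k%:Z - s) by apply: mulr_ge0; rewrite ?subr_ge0.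
have h9 : 0 <= s * s by apply: mulr_ge0.
by rewrite expr2; apply/andP; split; lra.
Qed.

Lemma seq_max_min_bounds (s : seq int) (lo hi : int) : s != [::] ->
  (forall z, z \in s -> lo <= z <= hi) ->
  0 <= seq_max s - seq_min s <= hi - lo.
Proof.
case: s => [//|h s] _ bd; rewrite /seq_max /seq_min /=.
have [h1 h2] : lo <= h /\ h <= hi by apply/andP; apply: bd; rewrite mem_head.
have maxP t : (forall z, z \in t -> z <= hi) -> h <= \big[Order.max/h]_(z <- t) z <= hi.
  elim: t => [|z t IH] bt; first by rewrite big_nil lexx.
  rewrite big_cons le_max ge_max bt ?mem_head //=.
  have [-> ->] : h <= \big[Order.max/h]_(z <- t) z /\ \big[Order.max/h]_(z <- t) z <= hi.
    by apply/andP; apply: IH => w wt; apply: bt; rewrite in_cons wt orbT.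
  by rewrite orbT.
have minP t : (forall z, z \in t -> lo <= z) -> lo <= \big[Order.min/h]_(z <- t) z <= h.
  elim: t => [|z t IH] bt; first by rewrite big_nil lexx h1.
  rewrite big_cons le_min ge_min bt ?mem_head //=.
  have [-> ->] : lo <= \big[Order.min/h]_(z <- t) z /\ \big[Order.min/h]_(z <- t) z <= h.
    by apply/andP; apply: IH => w wt; apply: bt; rewrite in_cons wt orbT.
  by rewrite orbT.
have /andP[a1 a2] := maxP (h :: s) (fun z zs => (andP (bd z zs)).2).
have /andP[b1 b2] := minP (h :: s) (fun z zs => (andP (bd z zs)).1).
by apply/andP; split; lra.
Qed.

Lemma area_le n (p : 'I_n -> int * int) (x0 x1 y0 y1 : int) : (0 < n)%N ->
  (forall v, x0 <= (p v).1 <= x1 /\ y0 <= (p v).2 <= y1) ->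
  area p <= (x1 - x0 + 1) * (y1 - y0 + 1).
Proof.
move=> n0 bd; rewrite /area /width /height.
have ne (f : 'I_n -> int) : [seq f v | v <- enum 'I_n] != [::].
  by rewrite -size_eq0 size_map size_enum_ord -lt0n.
have := seq_max_min_bounds (ne (fun v => (p v).1)) (_ : forall z, _ -> x0 <= z <= x1).
have := seq_max_min_bounds (ne (fun v => (p v).2)) (_ : forall z, _ -> y0 <= z <= y1).
move=> hy hx.
have /andP[x2 x3] := hx ltac:(by move=> z /mapP[v _ ->]; case: (bd v)).
have /andP[y2 y3] := hy ltac:(by move=> z /mapP[v _ ->]; case: (bd v)).
by apply: ler_pM; lra.
Qed.

Section Assembly.
Variables (n k : nat) (e : rel 'I_n) (pos : {perm 'I_n}) (T m : nat) (A B : nat -> nat).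
Hypotheses (n3 : (3 <= n)%N) (eG : simple_graph e).
Hypotheses (emb : outerplane_embedding e pos) (Tn : (T.+1 < n)%N).
Hypothesis side : forall u v, e u v -> (pos u < pos v)%N ->
  (pos u <= T)%N = (pos v <= T)%N -> pos v = (pos u).+1 :> nat.
Hypothesis AB0 : (A 0%N, B 0%N) = (0%N, 0%N).
Hypothesis ABm : (A m, B m) = (T, (n.-1 - T.+1)%N).
Hypothesis ABC : forall i, (i <= m)%N -> cross_edge e pos T (A i) (B i).
Hypothesis ABS : forall i, (i < m)%N ->
  [/\ (A i <= A i.+1)%N, (B i <= B i.+1)%N, (A i + B i < A i.+1 + B i.+1)%N &
      forall a b, cross_edge e pos T a b ->
        (a + b <= A i + B i)%N \/ (A i.+1 + B i.+1 <= a + b)%N].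
Hypothesis Ak : forall i, (i < m)%N -> (A i.+1 - A i <= k)%N.
Hypothesis Bk : forall i, (i < m)%N -> (B i.+1 - B i <= k)%N.
Variables (X Y rho tau : nat -> int).
Hypothesis AX : side_layout m A X (fun i => X i - Y i) rho.
Hypothesis BY : side_layout m B Y (fun i => Y i - X i) tau.

Local Notation slab := (strip_lab pos T).
Local Notation drawing := (fun v : 'I_n => lab_point m k A B X Y rho tau (slab v)).
Local Notation lpt := (lab_pt m k A B X Y rho tau).

Let ABlt i : (i < m)%N -> (A i + B i < A i.+1 + B i.+1)%N.
Proof. by move=> im; case: (ABS im). Qed.

Lemma strip_m_gt0 : (0 < m)%N.
Proof.
have [A0 B0] := AB0; have [Am Bm] := ABm.
by case: (posnP m) => // m0; move: Am Bm; rewrite m0 A0 B0; have := n3; lia.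
Qed.

Lemma strip_lab_inj : injective slab.
Proof.
move=> u v; rewrite /strip_lab; case: ifP => uT; case: ifP => vT // [] h.
  by apply/(@perm_inj _ pos)/val_inj.
apply/(@perm_inj _ pos)/val_inj => /=.
by have := ltn_ord (pos u); have := ltn_ord (pos v); lia.
Qed.

Lemma strip_lab_mem v : exists2 i, (i < m)%N & face_mem A B i (slab v).
Proof.
have m0 := strip_m_gt0; have [A0 B0] := AB0; have [Am Bm] := ABm.
have m1 : (m.-1 < m)%N by rewrite prednK.
have [Al Bl _ _] := ABS m1; rewrite prednK // in Al Bl.
rewrite /strip_lab; case: ifP => vT.
  have [lt|le] := ltnP (pos v) (A m).
    have [|i im /andP[h1 h2]] := @step_locate A m (pos v) _ lt; first by rewrite A0.
    by exists i => //; rewrite /face_mem /= h1 ltnW.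
  by exists m.-1 => //; rewrite /face_mem /= prednK //; lia.
have {}vT : (T < pos v)%N by rewrite ltnNge vT.
have [lt|le] := ltnP (n.-1 - pos v) (B m).
  have [|i im /andP[h1 h2]] := @step_locate B m (n.-1 - pos v) _ lt; first by rewrite B0.
  by exists i => //; rewrite /face_mem /= h1 ltnW.
by exists m.-1 => //; rewrite /face_mem /= prednK // (leq_trans Bl le) Bm leq_sub2l.
Qed.

Lemma strip_lab_surj i l : (i < m)%N -> face_mem A B i l -> exists v, slab v = l.
Proof.
move=> im; have [aT bS _] := ABC im; rewrite /strip_lab.
case: l => [[] c]; rewrite /face_mem /= => /andP[_ h].
  have cn : (c < n)%N by lia.
  have [v vc] := pos_surj pos cn; exists v; move: vc => /= ->.
  by have -> : (c <= T)%N by lia.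
have cn : (n.-1 - c < n)%N by lia.
have [v vc] := pos_surj pos cn; exists v; move: vc => /= ->.
have -> : (n.-1 - c <= T)%N = false by lia.
by congr pair; lia.
Qed.

Lemma strip_edgeE u v : e u v <-> exists2 i, (i < m)%N &
  face_edge A B i (slab u) (slab v) || face_edge A B i (slab v) (slab u).
Proof. exact: (strip_edge n3 eG emb Tn side AB0 ABm ABC ABS). Qed.

Lemma drawing_setE : drawing_set e drawing = drawn m k A B X Y rho tau.
Proof.
apply/seteqP; split=> z /=.
  move=> [u [v [/strip_edgeE[i im /orP[h|h]] sz]]].
    by exists i, (slab u), (slab v).
  by exists i, (slab v), (slab u); split => //; apply: segmentC.
move=> [i [l [l' [im ll' sz]]]].
have [lm lm'] := face_edge_mem AX BY im ll'.
have [u ul] := strip_lab_surj im lm; have [v vl] := strip_lab_surj im lm'; subst l l'.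
by exists u, v; split => //; apply/strip_edgeE; exists i; rewrite ?ll'.
Qed.

Lemma drawing_planar : planar_straight_line e drawing.
Proof.
split.
  move=> u v uv; apply: strip_lab_inj.
  have [i im um] := strip_lab_mem u; have [j jm vm] := strip_lab_mem v.
  apply: (lab_pt_inj AX BY ABlt Ak Bk im jm um vm).
  by rewrite /lab_pt uv.
have oriented a b c d i j z : (i < m)%N -> (j < m)%N ->
    face_edge A B i (slab a) (slab b) -> face_edge A B j (slab c) (slab d) ->
    ~~ ((a == c) && (b == d) || (a == d) && (b == c)) ->
    segment (lpt (slab a)) (lpt (slab b)) z -> segment (lpt (slab c)) (lpt (slab d)) z ->
    exists2 v, ((v == a) || (v == b)) && ((v == c) || (v == d)) & z = lpt (slab v).
  move=> im jm ab cd ne s1 s2.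
  have ne' : ~~ ((slab a == slab c) && (slab b == slab d) ||
      (slab a == slab d) && (slab b == slab c)) by rewrite !(inj_eq strip_lab_inj).
  have [u /andP[ua uc] ->] := face_edges_meet AX BY ABlt Ak Bk im jm ab cd ne' s1 s2.
  by case/orP: ua uc => /eqP-> uc; [exists a | exists b];
    rewrite // eqxx ?orbT /= -!(inj_eq strip_lab_inj).
move=> a b c d /strip_edgeE[i im /orP[ab|ab]] /strip_edgeE[j jm /orP[cd|cd]] ne z s1 s2.
- exact: (oriented a b c d i j).
- have [|v h ->] := oriented a b d c i j z im jm ab cd _ s1 (segmentC s2).
    by rewrite orbC.
  by exists v => //; move: h; rewrite [(v == d) || _]orbC.
- have [|v h ->] := oriented b a c d i j z im jm ab cd _ (segmentC s1) s2.
    by rewrite orbC andbC [(b == c) && _]andbC.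
  by exists v => //; move: h; rewrite [(v == b) || _]orbC.
- have [|v h ->] := oriented b a d c i j z im jm ab cd _ (segmentC s1) (segmentC s2).
    by rewrite [(b == d) && _]andbC [(b == c) && _]andbC.
  by exists v => //; move: h; rewrite [(v == b) || _]orbC [(v == d) || _]orbC.
Qed.

Lemma drawing_convex : internally_strictly_convex e drawing.
Proof.
split; first exact: drawing_planar.
move=> F [z]; rewrite drawing_setE => nz [FE bF].
have := drawn_bounded_component AX BY ABlt Ak Bk strip_m_gt0 nz.
rewrite -FE => /(_ bF)[cF xF]; split => // v.
by have [i im vm] := strip_lab_mem v; apply: xF im vm.
Qed.

Lemma drawing_area (M : int) : (k <= n)%N -> (0 < k)%N -> 0 <= M ->
  (forall j, (j <= m)%N -> [/\ 0 <= X j <= M, 0 <= Y j <= M, - M <= rho j <= M &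
    - M <= tau j <= M]) ->
  area drawing <= (4 * (M * k%:Z) + n%:Z * k%:Z + 1) * (4 * k%:Z + 1).
Proof.
move=> kn k0 M0 bd.
have -> : 4 * (M * k%:Z) + n%:Z * k%:Z + 1 =
  3 * (M * k%:Z) + n%:Z * k%:Z - (- (M * k%:Z)) + 1 by ring.
have -> : 4 * k%:Z + 1 = 3 * k%:Z - (- k%:Z) + 1 by ring.
apply: area_le; first by lia.
move=> v; have [i im] := strip_lab_mem v; rewrite /lab_point.
case: (slab v) => [[] c] h.
  have := side_point_bounds AX im (h : (A i <= c <= A i.+1)%N) (Ak im) kn (M := M).
  rewrite /fst /snd; case: (side_point _ _ _ _ _ _) => u w /(_ _)[|h1 /andP[h2 h3]].
    by move=> j /bd[].
  by split => //; apply/andP; split; lra.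
have := side_point_bounds BY im (h : (B i <= c <= B i.+1)%N) (Bk im) kn (M := M).
rewrite /fst /snd; case: (side_point _ _ _ _ _ _) => u w /(_ _)[|h1 /andP[h2 h3]].
  by move=> j /bd[].
by split => //; apply/andP; split; lra.
Qed.

End Assembly.

Local Close Scope classical_set_scope.

Theorem theorem12 :
  exists C : RR, 0 < C /\
    forall (n k : nat), (3 <= n)%N -> (3 <= k)%N ->
    forall (e : rel 'I_n) (pos : {perm 'I_n}),
      simple_graph e -> outerpath e pos ->
      (forall F, internal_face e pos F -> (#|F| <= k)%N) ->
      exists p : 'I_n -> int * int,
        internally_strictly_convex e p /\
        (area p)%:~R <= C * n%:R * k%:R ^+ 2.
Proof.
exists 70; split => // n k n3 k3 e pos eG [emb0 dual] Fk0.
have [pos' [T [Tn emb face side]]] := strip_position n3 eG emb0 dual.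
have Fk F : internal_face e pos' F -> (#|F| <= k)%N by move/face; exact: Fk0.
have [m [A [B [AB0 ABm ABC ABS]]]] := strip_chain n3 eG emb Tn.
have AB1 i : (i < m)%N ->
    [/\ (A i <= A i.+1)%N, (B i <= B i.+1)%N & (A i + B i < A i.+1 + B i.+1)%N].
  by move=> /ABS[].
have [X [Y [rho [tau [AX BY [X0 Y0] bd pot]]]]] := layout_exists AB1.
(* A face has at most [n] vertices too, so [h] is a valid size bound with [h <= n], as
   [drawing_area] requires. *)
pose h := minn k n.
have size i : (i < m)%N -> (A i.+1 - A i <= h)%N /\ (B i.+1 - B i <= h)%N.
  move=> im; have [F /Fk Fk' le] := strip_face n3 eG emb Tn side ABC ABS im.
  have Fn : (#|F| <= n)%N by rewrite -[X in (_ <= X)%N]card_ord max_card.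
  by rewrite /h; split; lia.
have Ak i : (i < m)%N -> (A i.+1 - A i <= h)%N by case/size.
have Bk i : (i < m)%N -> (B i.+1 - B i <= h)%N by case/size.
exists (fun v => lab_point m h A B X Y rho tau (strip_lab pos' T v)); split.
  exact: (drawing_convex n3 eG emb Tn side AB0 ABm ABC ABS Ak Bk AX BY).
have hn : (h <= n)%N by rewrite geq_minr.
have h0 : (0 < h)%N by rewrite /h; lia.
have [A0 B0] := AB0; have [Am Bm] := ABm.
have rt0 : rho 0%N <= 0 /\ tau 0%N <= 0.
  by have := AX.1 0%N isT; have := BY.1 0%N isT; rewrite X0 Y0 subrr.
(* The potential bounds the width because [rho 0] and [tau 0] are nonpositive; the slopes are
   bounded by the same quantity, whence [M = 3 * n]. *)
have XY : X m + Y m <= 3 * n%:Z.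
  by move: pot; rewrite Am Bm A0 B0; lia.
have := drawing_area n3 Tn AB0 ABm ABS Ak Bk AX BY (M := 3 * n%:Z) hn h0.
move=> /(_ isT) H; have {}H := H ltac:(
  move=> j jm; have [b1 b2 b3 b4] := bd j jm;
  have := AX.1 j jm; have := BY.1 j jm; move=> /= ? ?; split; lia).
have hk : h%:Z <= k%:Z by rewrite lez_nat geq_minl.
have : area (fun v => lab_point m h A B X Y rho tau (strip_lab pos' T v)) <=
    70 * n%:Z * (k%:Z * k%:Z).
  apply: le_trans H _.
  (* The width is at most [13 * n * h + 1] and the height at most [4 * h + 1], so 70 is [14 * 5]. *)
  apply: (@le_trans _ _ ((14 * (n%:Z * k%:Z)) * (5 * k%:Z))).
    have nk : n%:Z * h%:Z <= n%:Z * k%:Z by apply: ler_wpM2l.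
    have nk1 : 1 <= n%:Z * h%:Z by rewrite -PoszM lez_nat muln_gt0 h0 andbT; lia.
    by apply: ler_pM; lia.
  by rewrite le_eqVlt; apply/orP; left; apply/eqP; ring.
by rewrite -(ler_int RR) !rmorphM expr2.
Qed.
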